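(* Let $G$ be a simply connected five dimensional nilpotent Lie group with a left invariant Riemannian metric $\tilde a$, whose Lie algebra $\mathfrak l_{5,5}$ has an $\tilde a$-orthonormal basis $\{E_1,\dots,E_5\}$ with non-zero brackets $[E_1,E_2]=aE_4+bE_5$, $[E_1,E_3]=cE_5$, $[E_1,E_4]=dE_5$, $[E_2,E_3]=eE_5$, where $a,d,e>0$ and $b,c\ge0$. Let $F(x,y)=\sqrt{\tilde a(y,y)}+\tilde a(X(x),y)$ be a Randers metric of Douglas type on $G$, where $X$ is a left invariant vector field with $\sqrt{\tilde a(X,X)}<1$. Then a non-zero vector $Y$ of the Lie algebra is a geodesic vector of $(G,F)$ if and only if $Y\in\operatorname{span}\{E_1,E_2,E_3\}$ or $Y\in\operatorname{span}\{E_3,E_4\}$ or $Y\in\operatorname{span}\{E_5\}$.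
   Context: Brackets of basis elements not listed (and not obtained by antisymmetry) are zero. The spray coefficients of $F$ in standard local coordinates $(x,y)$ of the tangent bundle are $G^i=\frac14 g^{il}\big([F^2]_{x^my^l}y^m-[F^2]_{x^l}\big)$, where $g_{ij}=\frac12\frac{\partial^2F^2}{\partial y^i\partial y^j}$. $F$ is of Douglas type if in every standard local coordinate system $G^i=\frac12\Gamma^i_{jk}(x)y^jy^k+P(x,y)y^i$ for some functions $\Gamma^i_{jk}(x)$ and some local function $P(x,y)$ positively homogeneous of degree one in $y$. A non-zero vector $Y$ of the Lie algebra is a geodesic vector of $(G,F)$ if the curve $t\mapsto\exp(tY)$ is a geodesic of $(G,F)$. *)

(* Defs.v *)
From HB Require Import structures.
From mathcomp Require Import all_boot all_order all_algebra.
From mathcomp Require Import all_classical all_reals all_analysis.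
Import Order.TTheory GRing.Theory Num.Theory.
Import numFieldNormedType.Exports.

Set Implicit Arguments.
Unset Strict Implicit.
Unset Printing Implicit Defensive.

Local Open Scope classical_set_scope.
Local Open Scope ring_scope.

(* [Ck k D f] requires k-fold iterated directional derivatives in all
   directions; on an open subset of a finite dimensional space this is the
   usual class C^k. *)
Fixpoint Ck (R : realType) (V W : normedModType R) (k : nat) (D : set V)
    (f : V -> W) : Prop :=
  if k is k'.+1 then
    (forall x, D x -> differentiable f x) /\
    (forall v, Ck k' D (fun x => 'D_v f x))
  else forall x, D x -> {for x, continuous f}.

Definition smooth_on (R : realType) (V W : normedModType R) (D : set V)
  (f : V -> W) : Prop := forall k, Ck k D f.

(* A local coordinate system of a space M: [cmap] and [cinv] are total
   functions, but only the restriction of [cmap] to [cdom] and that of [cinv] to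
   the image [cimg] are meaningful. *)
Record chart (R : realType) (n : nat) (M : Type) := Chart {
  cdom : set M;
  cmap :> M -> 'rV[R]_n;
  cinv : 'rV[R]_n -> M }.

Definition cimg (R : realType) (n : nat) (M : Type) (phi : chart R n M) :
  set 'rV[R]_n := phi @` cdom phi.

Definition is_chart (R : realType) (n : nat) (M : topologicalType)
    (phi : chart R n M) : Prop :=
  [/\ open (cdom phi), open (cimg phi),
      forall p, cdom phi p -> cinv phi (phi p) = p,
      forall p, cdom phi p -> {for p, continuous (cmap phi)} &
      forall u, cimg phi u -> {for u, continuous (cinv phi)}].

Definition compatible (R : realType) (n : nat) (M : topologicalType)
    (phi psi : chart R n M) : Prop :=
  smooth_on (phi @` (cdom phi `&` cdom psi)) (fun u => psi (cinv phi u)) /\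
  smooth_on (psi @` (cdom phi `&` cdom psi)) (fun u => phi (cinv psi u)).

HB.mixin Record isManifold (R : realType) (n : nat) M & Topological M := {
  atlas : set (chart R n M);
  atlas_chart : forall phi, atlas phi -> is_chart phi;
  atlas_cover : forall p : M, exists2 phi, atlas phi & cdom phi p;
  atlas_compatible : forall phi psi,
    atlas phi -> atlas psi -> compatible phi psi;
  atlas_maximal : forall phi, is_chart phi ->
    (forall psi, atlas psi -> compatible phi psi) -> atlas phi;
  manifold_hausdorff : hausdorff_space M;
  manifold_second_countable : @second_countable M
}.

#[short(type="manifoldType")]
HB.structure Definition Manifold (R : realType) (n : nat) :=
  {M of Topological M & isManifold R n M}.

#[short(type="groupManifoldType")]
HB.structure Definition GroupManifold (R : realType) (n : nat) :=
  {G of Manifold R n G & Group G}.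

HB.mixin Record isLieGroup (R : realType) (n : nat) G
    & GroupManifold R n G := {
  lie_mulg_continuous : continuous (fun pq : G * G => (pq.1 * pq.2)%g);
  lie_invg_continuous : continuous (fun p : G => (p^-1)%g);
  lie_mulg_smooth : forall phi psi chi : chart R n G,
    atlas phi -> atlas psi -> atlas chi ->
    smooth_on [set uv : 'rV[R]_n * 'rV[R]_n | [/\ cimg phi uv.1,
        cimg psi uv.2 & cdom chi (cinv phi uv.1 * cinv psi uv.2)%g]]
      (fun uv => chi (cinv phi uv.1 * cinv psi uv.2)%g);
  lie_invg_smooth : forall phi chi : chart R n G,
    atlas phi -> atlas chi ->
    smooth_on [set u | cimg phi u /\ cdom chi (cinv phi u)^-1%g]
      (fun u => chi (cinv phi u)^-1%g)
}.

#[short(type="lieGroupType")]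
HB.structure Definition LieGroup (R : realType) (n : nat) :=
  {G of GroupManifold R n G & isLieGroup R n G}.

Section Topology.
Context (R : realType) (T : topologicalType).

Definition is_path (f : R -> T) (p q : T) : Prop :=
  [/\ {within `[0, 1], continuous f}, f 0 = p & f 1 = q].

Definition null_homotopic (f : R -> T) (p : T) : Prop :=
  exists H : R * R -> T,
    {within `[0, 1] `*` `[0, 1], continuous H} /\
    (forall s, s \in `[0, 1] -> [/\ H (s, 0) = f s, H (s, 1) = p,
                                    H (0, s) = p & H (1, s) = p]).

Definition simply_connected : Prop :=
  (forall p q : T, exists f, is_path f p q) /\
  (forall (p : T) f, is_path f p p -> null_homotopic f p).

End Topology.

Fixpoint upper_central (G : groupType) (k : nat) : set G :=
  if k is k'.+1 then [set x | forall y, upper_central k' [~ x, y]%g]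
  else [set 1%g].

Definition nilpotent_group (G : groupType) : Prop :=
  exists k, upper_central k = [set: G].

Section Manifold.
Context (R : realType) (n : nat) (M : manifoldType R n).

Definition chart_at (p : M) (phi : chart R n M) : Prop :=
  atlas phi /\ cdom phi p.

(* The differential at p of f : M -> M, expressed in the coordinates phi around
   p and psi around f p. *)
Definition dmap (f : M -> M) (phi psi : chart R n M) (p : M)
  (v : 'rV[R]_n) : 'rV[R]_n := 'D_v (fun u => psi (f (cinv phi u))) (phi p).

(* [Y p phi] is the row of components at p of the vector field Y in the local
   coordinates phi. The components are required to be 0 when phi is not a
   coordinate system around p, so that Leibniz equality and the pointwise linear
   structure on [vfield] are those of vector fields. *)
Definition vfield := M -> chart R n M -> 'rV[R]_n.

Definition is_vfield (Y : vfield) : Prop :=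
  [/\ forall p phi, ~ chart_at p phi -> Y p phi = 0,
      forall p phi psi, chart_at p phi -> chart_at p psi ->
        Y p psi = dmap id phi psi p (Y p phi) &
      forall phi, atlas phi ->
        smooth_on (cimg phi) (fun u => Y (cinv phi u) phi)].

Definition lie_bracket (Y Z : vfield) : vfield := fun p phi =>
  if `[< chart_at p phi >] then
    'D_(Y p phi) (fun u => Z (cinv phi u) phi) (phi p) -
    'D_(Z p phi) (fun u => Y (cinv phi u) phi) (phi p)
  else 0.

(* [g p phi] is the matrix (g_ij) at p in the local coordinates phi; its values
   for charts that are not around p are irrelevant. *)
Definition metric := M -> chart R n M -> 'M[R]_n.

Definition inner (g : metric) (p : M) (phi : chart R n M)
  (v w : 'rV[R]_n) : R := (v *m g p phi *m w^T) 0 0.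

Definition riemannian_metric (g : metric) : Prop :=
  [/\ forall p phi, chart_at p phi -> (g p phi)^T = g p phi,
      forall p phi v, chart_at p phi -> v != 0 -> 0 < inner g p phi v v,
      forall p phi psi v w, chart_at p phi -> chart_at p psi ->
        inner g p psi (dmap id phi psi p v) (dmap id phi psi p w) =
        inner g p phi v w &
      forall phi, atlas phi ->
        smooth_on (cimg phi) (fun u => g (cinv phi u) phi)].

Definition orthonormal_frame (k : nat) (g : metric) (E : k.-tuple vfield) : Prop :=
  forall (i j : 'I_k) p phi, chart_at p phi ->
    inner g p phi (tnth E i p phi) (tnth E j p phi) = (i == j)%:R.

(* [F p phi y] is the value of F at the tangent vector at p with components y
   in the local coordinates phi. *)
Definition finsler := M -> chart R n M -> 'rV[R]_n -> R.

Definition randers (g : metric) (X : vfield) : finsler := fun p phi y =>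
  Num.sqrt (inner g p phi y y) + inner g p phi (X p phi) y.

(* Here x is the coordinate vector of a point and y that of a tangent vector. *)
Section Spray.
Context (F : finsler) (phi : chart R n M).

Definition sqF (x y : 'rV[R]_n) : R := F (cinv phi x) phi y ^+ 2.

Definition ebasis (i : 'I_n) : 'rV[R]_n := delta_mx 0 i.

Definition sqF_x (m : 'I_n) (x y : 'rV[R]_n) : R :=
  'D_(ebasis m) (fun x' => sqF x' y : R^o) x.

Definition sqF_y (m : 'I_n) (x y : 'rV[R]_n) : R :=
  'D_(ebasis m) (fun y' => sqF x y' : R^o) y.

Definition sqF_xy (m l : 'I_n) (x y : 'rV[R]_n) : R :=
  'D_(ebasis l) (fun y' => sqF_x m x y' : R^o) y.

Definition sqF_yy (i j : 'I_n) (x y : 'rV[R]_n) : R :=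
  'D_(ebasis j) (fun y' => sqF_y i x y' : R^o) y.

Definition fundamental_tensor (x y : 'rV[R]_n) : 'M[R]_n :=
  \matrix_(i, j) (2^-1 * sqF_yy i j x y).

Definition spray (x y : 'rV[R]_n) (i : 'I_n) : R :=
  4^-1 * \sum_l invmx (fundamental_tensor x y) i l *
    (\sum_m sqF_xy m l x y * y 0 m - sqF_x l x y).

End Spray.

Definition douglas (F : finsler) : Prop :=
  forall phi, atlas phi ->
  exists (Gamma : 'I_n -> 'I_n -> 'I_n -> 'rV[R]_n -> R)
         (P : 'rV[R]_n -> 'rV[R]_n -> R),
    (forall x y (lambda : R), cimg phi x -> y != 0 -> 0 < lambda ->
      P x (lambda *: y) = lambda * P x y) /\
    (forall x y i, cimg phi x -> y != 0 ->
      spray F phi x y i =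
      2^-1 * (\sum_j \sum_k Gamma i j k x * y 0 j * y 0 k) + P x y * y 0 i).

Definition smooth_curve (gamma : R -> M) : Prop :=
  continuous gamma /\
  forall phi, atlas phi ->
    smooth_on [set t : R^o | cdom phi (gamma t)] (fun t => phi (gamma t)).

(* Geodesics are regular curves with constant speed parametrization. The spray is
   meaningful on nonzero vectors only. *)
Definition geodesic (F : finsler) (gamma : R -> M) : Prop :=
  smooth_curve gamma /\
  forall t phi, chart_at (gamma t) phi ->
    let x : R -> 'rV[R]_n := fun s => phi (gamma s) in
    x^`()%classic t != 0 /\
    forall i, x^`(2)%classic t 0 i + 2 * spray F phi (x t) (x^`()%classic t) i = 0.

Definition in_span (k : nat) (E : k.-tuple vfield) (Y : vfield) : Prop :=
  exists y : 'I_k -> R, Y = \sum_i y i *: tnth E i.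

End Manifold.

Section LieGroup.
Context (R : realType) (n : nat) (G : lieGroupType R n).

(* The Lie algebra of G consists of the left invariant vector fields. *)
Definition left_invariant (Y : vfield G) : Prop :=
  is_vfield Y /\
  forall (h p : G) phi psi, chart_at p phi -> chart_at (h * p)%g psi ->
    Y (h * p)%g psi = dmap (fun q => (h * q)%g) phi psi p (Y p phi).

Definition left_invariant_metric (g : metric G) : Prop :=
  forall (h p : G) phi psi v w, chart_at p phi -> chart_at (h * p)%g psi ->
    inner g (h * p)%g psi (dmap (fun q => (h * q)%g) phi psi p v)
      (dmap (fun q => (h * q)%g) phi psi p w) = inner g p phi v w.

Definition lie_algebra_basis (k : nat) (E : k.-tuple (vfield G)) : Prop :=
  (forall i, left_invariant (tnth E i)) /\
  (forall Y, left_invariant Y ->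
    exists! y : {ffun 'I_k -> R}, Y = \sum_i y i *: tnth E i).

Definition one_param_subgroup (Y : vfield G) (gamma : R -> G) : Prop :=
  [/\ smooth_curve gamma,
      forall s t, gamma (s + t) = (gamma s * gamma t)%g &
      forall phi, chart_at 1%g phi ->
        (fun t => phi (gamma t))^`()%classic 0 = Y 1%g phi].

(* Every left invariant Y generates exactly one one-parameter subgroup gamma, and
   exp Y = gamma 1; the default value of [xget] is never used for such Y. *)
Definition lie_exp (Y : vfield G) : G :=
  xget (fun=> 1%g) (one_param_subgroup Y) 1.

Definition geodesic_vector (F : finsler G) (Y : vfield G) : Prop :=
  [/\ left_invariant Y, Y <> 0 & geodesic F (fun t => lie_exp (t *: Y))].

End LieGroup.

(* Main.v *)
(* At a vector y = Y(p), the Euler-Lagrange equations of F^2 contracted with a left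
   invariant field Z express the geodesic equation of an integral curve of Y. Since
   a~(Y, Z) and beta(Z) = a~(X, Z) are constant, the contraction is, up to a positive
   factor, a~(Y, [Y, Z]) / |Y| + beta([Y, Z]). Once the projective factor P is
   eliminated, the Riemannian part of the spray equations is even in y and the
   contribution of d(beta) is odd; hence the Douglas condition forces d(beta) = 0, that
   is, beta([Y, Z]) = 0. As the fundamental tensor is nondegenerate, Y is a geodesic vector
   if and only if a~(Y, [Y, E_i]) = 0 for all i, and these quadratic equations have the
   stated solutions. That t |-> exp(tY) is an integral curve of Y rests on the
   existence (Picard iteration) and uniqueness of one-parameter subgroups. *)

Require Import Defs.
From HB Require Import structures.
From mathcomp Require Import all_boot all_order all_algebra.
From mathcomp Require Import all_classical all_reals all_analysis.
From mathcomp Require Import ring lra.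
Import Order.TTheory GRing.Theory Num.Theory.
Import numFieldNormedType.Exports.
Set Implicit Arguments.
Unset Strict Implicit.
Unset Printing Implicit Defensive.
Local Open Scope classical_set_scope.
Local Open Scope ring_scope.

(** * Ordinary differential equations *)

(** [lie_exp] is a choice among one-parameter subgroups, so nothing can be said about it until a
    subgroup is built and shown to be unique. The flow of [Y] is constructed only for short times,
    in one chart at the identity; uniqueness makes it a local homomorphism, and the powers
    [g (t / N) ^+ N] extend it to all times, so no flow has to be continued from chart to chart. The
    inverse of the fundamental tensor is never computed: the spray enters only through its
    contractions with that tensor. Nondegeneracy comes from |X| < 1, which makes F positive, and
    from the equality case of Cauchy-Schwarz. Testing against the frame loses nothing because its
    values span each tangent space. Differentiating constant inner products trades derivatives of
    the metric for derivatives of the fields, and these assemble into Lie brackets. One implication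
    uses the geodesic equation at time 0 only; the other uses that the resulting algebraic equations
    hold at every point. *)

Section RowVectors.
Context {R : realType} {n : nat}.
Implicit Types x : 'rV[R]_n.

Lemma rV_coord_norm_le x i : `|x 0 i| <= `|x|.
Proof.
rewrite [leRHS]/Num.norm/= mx_normrE.
exact: (le_bigmax _ (fun ij => `|x ij.1 ij.2|) (0, i)).
Qed.

Lemma rV_norm_le x B : 0 <= B -> (forall i, `|x 0 i| <= B) -> `|x| <= B.
Proof.
move=> B0 xB; rewrite [leLHS]/Num.norm/= mx_normrE.
by apply: bigmax_le => // -[i j] _ /=; rewrite ord1.
Qed.

End RowVectors.

Section OneVariable.
Context {R : realType}.

Lemma is_derive_coord (V : normedModType R) m n (M : V -> 'M[R]_(m, n)) x v dM i j :
  is_derive x v M dM -> is_derive x v (fun y => M y i j) (dM i j).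
Proof.
move=> [dM1 dM2]; apply: DeriveDef; first exact: (derivable_mxP M x v).1.
by rewrite -dM2 derive_mx // mxE.
Qed.

Lemma is_derive_mx (V : normedModType R) m n (M : V -> 'M[R]_(m, n)) x v
    (dM : 'M[R]_(m, n)) :
  (forall i j, is_derive x v (fun y => M y i j) (dM i j)) -> is_derive x v M dM.
Proof.
move=> dMij; have dM1 : derivable M x v.
  by apply/derivable_mxP => i j; have [] := dMij i j.
apply: DeriveDef => //; rewrite derive_mx //; apply/matrixP => i j.
by rewrite mxE; have [_ ->] := dMij i j.
Qed.

Lemma is_derive1_continuous (V : normedModType R) (f : R -> V) (x : R) (df : V) :
  is_derive x (1 : R) f df -> {for x, continuous f}.
Proof. by move=> [/derivable1_diffP/differentiable_continuous]. Qed.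

Lemma lipschitz_continuous (V W : normedModType R) (f : V -> W) K :
  (forall x y, `|f x - f y| <= K * `|x - y|) -> continuous f.
Proof.
move=> fK x; have K1 : 0 < `|K| + 1 by rewrite ltr_wpDl.
apply/cvgrPdist_le => e e0; near=> y.
rewrite (le_trans (fK _ _)) // (@le_trans _ _ ((`|K| + 1) * `|x - y|)) //.
  by rewrite ler_wpM2r // (le_trans (ler_norm _)) // lerDl.
rewrite mulrC -ler_pdivlMr //; near: y.
by apply: cvgr_dist_le; [exact: cvg_id | rewrite divr_gt0].
Unshelve. all: by end_near. Qed.

Lemma continuous_antiderivative (h : R -> R) (T : R) : continuous h ->
  exists H : R -> R,
    H 0 = 0 /\ forall t : R, `|t| <= T -> is_derive t 1 H (h t).
Proof.
(* The interval of integration is strictly larger than [-T, T], so every time considered is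
   interior, as the fundamental theorem of calculus requires. *)
move=> ch; set a := - (`|T| + 1); set u := `|T| + 1.
have hint : lebesgue_measure.-integrable `[a, u] (EFin \o h).
  apply: continuous_compact_integrable; first exact: segment_compact.
  exact: continuous_subspaceT.
pose F x := (\int[lebesgue_measure]_(t in `[a, x]) h t)%R.
have dF (t : R) : `|t| <= T -> is_derive t 1 F (h t).
  move=> tT; have /andP[ta tu] : a < t < u.
    rewrite -ltr_norml /u (le_lt_trans tT) // (le_lt_trans (ler_norm T)) //.
    by rewrite ltrDl.
  have [dF F't] := continuous_FTC1_closed tu hint ta (ch t).
  by split; [exact: dF | rewrite -derive1E; exact: F't].
exists (fun x => F x - F 0); split; first by rewrite subrr.
move=> t tT; have := dF t tT => dFt.
have -> : (fun x => F x - F 0) = F - cst (F 0) by [].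
by apply: is_derive_eq; rewrite subr0.
Qed.

Lemma derive_bound_lipschitz (f df : R -> R) (T B : R) :
  (forall t : R, `|t| <= T -> is_derive t 1 f (df t)) ->
  (forall t : R, `|t| <= T -> `|df t| <= B) ->
  forall s t : R, `|s| <= T -> `|t| <= T -> `|f s - f t| <= B * `|s - t|.
Proof.
move=> dfE dfB.
have H (s t : R) : `|s| <= T -> `|t| <= T -> s <= t -> `|f t - f s| <= B * `|t - s|.
  rewrite !ler_norml => /andP[s1 s2] /andP[t1 t2] st.
  have in_itv (x : R) : x \in `[s, t] -> `|x| <= T.
    by rewrite in_itv/= ler_norml => /andP[x1 x2]; rewrite (le_trans s1) // (le_trans x2).
  have [//|x /subset_itv_oo_cc/in_itv xT||c cst ->] := @MVT_segment R f df s t.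
  - exact: dfE.
  - by apply: derivable_within_continuous => x /in_itv/dfE[].
  - by rewrite -ler_norml normrM ler_wpM2r // dfB // in_itv.
move=> s t sT tT; have [/(H _ _ sT tT)|/ltW/(H _ _ tT sT)] := leP s t => //.
by rewrite distrC [in X in _ <= X]distrC.
Qed.

(** The mean value theorem has no vector-valued form, but the norm of a row is the maximum of its
    coordinates, so the scalar bound carries over with the same constant. *)
Lemma derive_bound_lipschitz_rV n (f df : R -> 'rV[R]_n) (T B : R) : 0 <= B ->
  (forall t : R, `|t| <= T -> is_derive t 1 f (df t)) ->
  (forall t : R, `|t| <= T -> `|df t| <= B) ->
  forall s t : R, `|s| <= T -> `|t| <= T -> `|f s - f t| <= B * `|s - t|.
Proof.
move=> B0 dfE dfB s t sT tT; apply: rV_norm_le => [|i]; first by rewrite mulr_ge0.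
rewrite !mxE.
apply: (@derive_bound_lipschitz (fun t => f t 0 i) (fun t => df t 0 i) T B _ _ s t sT tT).
  by move=> r rT; apply: is_derive_coord; exact: dfE.
by move=> r rT; apply: le_trans (dfB r rT); exact: rV_coord_norm_le.
Qed.

(** Retraction of the line onto [a - r, a + r] for r >= 0. It serves twice: on the time variable, to
    make a curve known on [-T, T] continuous everywhere, and on coordinates, to localize a vector
    field. *)
Definition clamp (a r x : R) : R := Num.max (a - r) (Num.min (a + r) x).

Lemma clamp_near a r x : 0 <= r -> `|clamp a r x - a| <= r.
Proof.
move=> r0; rewrite /clamp ler_norml; case: (lerP (a + r) x) => ?.
  by case: (lerP (a - r) (a + r)); lra.
by case: (lerP (a - r) x); lra.
Qed.

Lemma clamp_id a r x : `|x - a| <= r -> clamp a r x = x.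
Proof.
rewrite /clamp ler_norml => /andP[? ?].
case: (lerP (a + r) x) => ?; last by case: (lerP (a - r) x); lra.
by case: (lerP (a - r) (a + r)); lra.
Qed.

Lemma clamp_lipschitz a r x y : 0 <= r -> `|clamp a r x - clamp a r y| <= `|x - y|.
Proof.
move=> r0; rewrite /clamp.
wlog xy : x y / x <= y.
  move=> H; have [/H//|/ltW/H] := leP x y.
  by rewrite distrC [in X in _ <= X]distrC.
rewrite (distrC x) (ger0_norm (_ : 0 <= y - x)) ?subr_ge0 // ler_norml.
by case: (lerP (a + r) x); case: (lerP (a + r) y) => ? ?;
  rewrite ?(max_r (_ : a - r <= a + r)); try lra;
  case: (lerP (a - r) y) => ?; try case: (lerP (a - r) x) => ?; lra.
Qed.

End OneVariable.

(** * Picard iteration for bounded Lipschitz fields *)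

Section Picard.
Context {R : realType}.

Lemma geometric_half_lt (C e : R) : 0 < e -> exists k, C * 2^-1 ^+ k < e.
Proof.
move=> e0; have : geometric C (2^-1 : R) k @[k --> \oo] --> (0 : R).
  by apply: cvg_geometric; rewrite ger0_norm //; lra.
move=> /cvgr_lt/(_ _ e0)[k _ /(_ k (leqnn k))] /= ke.
by exists k.
Qed.

Lemma geometric_half_le0 (C x : R) : (forall k, x <= C * 2^-1 ^+ k) -> x <= 0.
Proof.
move=> xk; apply/ler_addgt0Pl => e /(geometric_half_lt C)[k Ck].
by rewrite addr0 (le_trans (xk k)) // ltW.
Qed.

Context {n : nat}.
Implicit Types (f : 'rV[R]_n -> 'rV[R]_n) (x : 'rV[R]_n).

Lemma continuous_antiderivative_rV (h : R -> 'rV[R]_n) x (T : R) : continuous h ->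
  exists H : R -> 'rV[R]_n,
    H 0 = x /\ forall t : R, `|t| <= T -> is_derive t 1 H (h t).
Proof.
move=> ch; have /choice[H HP] i : exists Hi : R -> R,
    Hi 0 = 0 /\ forall t : R, `|t| <= T -> is_derive t 1 Hi (h t 0 i).
  apply: (@continuous_antiderivative R (fun t => h t 0 i)) => t.
  apply: (@continuous_comp _ _ _ h (fun M : 'rV[R]_n => M 0 i)); first exact: ch.
  exact: coord_continuous.
exists (fun t => x + \row_i H i t); split.
  by apply/rowP => i; rewrite !mxE (HP i).1 addr0.
move=> t tT; apply: is_derive_mx => i j; rewrite (ord1 i).
have -> : (fun y => (x + \row_i0 H i0 y) 0 j) = cst (x 0 j) + H j.
  by apply/funext => y; rewrite !mxE.
have := (HP j).2 t tT => Hj.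
by apply: is_derive_eq; rewrite add0r.
Qed.

(** With T = 1 / (2 K) each iteration halves the distance between successive curves. Boundedness of
    [f] makes every iterate [B]-Lipschitz, which is the only property needed to form the next
    one. *)
Lemma picard_bounded f x (K B : R) : 0 < K -> (forall y, `|f y| <= B) ->
  (forall y z, `|f y - f z| <= K * `|y - z|) ->
  exists (T : R) (u : R -> 'rV[R]_n), [/\ 0 < T, u 0 = x &
    forall t : R, `|t| <= T -> is_derive t 1 u (f (u t))].
Proof.
move=> K0 fB fK; pose T := (2 * K)^-1.
have T0 : 0 < T by rewrite invr_gt0 mulr_gt0.
have KT : K * T = 2^-1 by rewrite /T invfM mulrC mulfVK ?gt_eqF.
have B0 : 0 <= B by rewrite (le_trans _ (fB 0)).
have cT t : `|clamp 0 T t| <= T.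
  by have := clamp_near 0 t (ltW T0); rewrite subr0.
have cid t : `|t| <= T -> clamp 0 T t = t by move=> tT; rewrite clamp_id ?subr0.
have abs0 : `|0 : R| <= T by rewrite normr0 ltW.
have step (w : R -> 'rV[R]_n) :
    (forall s t, `|s| <= T -> `|t| <= T -> `|w s - w t| <= B * `|s - t|) ->
    exists H : R -> 'rV[R]_n, H 0 = x /\
      forall t : R, `|t| <= T -> is_derive t 1 H (f (w t)).
  move=> wB; have [|H [H0 dH]] :=
      @continuous_antiderivative_rV (fun t => f (w (clamp 0 T t))) x T.
    apply: (@lipschitz_continuous _ _ _ _ (K * B)) => s t.
    rewrite (le_trans (fK _ _)) // -mulrA ler_pM2l //.
    by rewrite (le_trans (wB _ _ (cT _) (cT _))) // ler_wpM2l // clamp_lipschitz // ltW.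
  exists H; split=> // t tT.
  by have := dH t tT; rewrite cid.
pose P w H := H 0 = x /\ forall t : R, `|t| <= T -> is_derive t 1 H (f (w t)).
(* The next iterate is chosen among the antiderivatives that [step] provides; the default [cst x] of
   [xget] never occurs, since [UB] keeps every iterate Lipschitz. *)
pose U k := iter k (fun w => xget (cst x) [set H | P w H]) (cst x).
have UB k : U k 0 = x /\
    forall s t, `|s| <= T -> `|t| <= T -> `|U k s - U k t| <= B * `|s - t|.
  elim: k => [|k [_ IH]] /=.
    by split=> // s t _ _; rewrite subrr normr0 mulr_ge0.
  have [H0 dH] := xgetPex (cst x) (step _ IH).
  split=> //; apply: (derive_bound_lipschitz_rV B0 dH) => t _; exact: fB.
have dU k : forall t : R, `|t| <= T -> is_derive t 1 (U k.+1) (f (U k t)).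
  by have [] := xgetPex (cst x) (step _ (UB k).2).
pose C := B * T.
have C0 : 0 <= C by rewrite mulr_ge0 // ltW.
have h0 k : 0 <= (2^-1 : R) ^+ k by rewrite exprn_ge0.
have D k t : `|t| <= T -> `|U k.+1 t - U k t| <= C * 2^-1 ^+ k.
  elim: k t => [|k IH] t tT.
    have := (UB 1%N).2 _ _ tT abs0; rewrite (UB 1%N).1 subr0 => H.
    by rewrite expr0 mulr1 (le_trans H) // ler_wpM2l.
  have dg (s : R) : `|s| <= T ->
      is_derive s 1 (U k.+2 - U k.+1) (f (U k.+1 s) - f (U k s)).
    by move=> sT; have := dU k.+1 s sT => ?; have := dU k s sT => ?; apply: is_deriveB.
  have gB : 0 <= K * (C * 2^-1 ^+ k) by rewrite !mulr_ge0 // ltW.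
  have H : `|(U k.+2 t - U k.+1 t) - (U k.+2 0 - U k.+1 0)|
      <= K * (C * 2^-1 ^+ k) * `|t - 0|.
    apply: (derive_bound_lipschitz_rV gB dg _ tT abs0).
    by move=> s sT; rewrite (le_trans (fK _ _)) // ler_pM2l // IH.
  rewrite !(UB _).1 subrr !subr0 in H; apply: le_trans H _.
  have -> : C * 2^-1 ^+ k.+1 = K * (C * 2^-1 ^+ k) * T.
    by rewrite exprS -KT; ring.
  by rewrite ler_wpM2l.
have DD k m t : `|t| <= T -> `|U (m + k)%N t - U k t| <= 2 * C * 2^-1 ^+ k.
  (* The bound is sharpened to the exact geometric tail, because the weaker bound is not preserved
     by the induction on [m]. *)
  move=> tT; apply: (@le_trans _ _ (2 * C * (2^-1 ^+ k - 2^-1 ^+ (m + k)))).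
    elim: m => [|m IH]; first by rewrite !subrr normr0 mulr0.
    rewrite -(subrKA (U (m + k)%N t)) (le_trans (ler_normD _ _)) //.
    rewrite (le_trans (lerD (D _ _ tT) IH)) // addSn exprS; lra.
  by apply: ler_wpM2l; [rewrite mulr_ge0 | rewrite gerBl].
pose w t := lim (U k t @[k --> \oo]).
have cvgU t : `|t| <= T -> cvg (U k t @[k --> \oo]).
  move=> tT; apply/cauchy_cvgP/cauchy_exP => e e0.
  have [k ke] := geometric_half_lt (2 * C) e0.
  exists (U k t); exists k => // m /= km; rewrite -ball_normE /= distrC.
  by rewrite -(subnK km) (le_lt_trans (DD _ _ _ tT)).
have wU k t : `|t| <= T -> `|w t - U k t| <= 2 * C * 2^-1 ^+ k.
  move=> tT; apply/ler_addgt0Pl => e e0.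
  have /cvgrPdist_le/(_ e e0)[m _ mU] := cvgU t tT.
  have {}mU : `|w t - U (m + k)%N t| <= e := mU (m + k)%N (leq_addr _ _).
  by rewrite -(subrKA (U (m + k)%N t)) (le_trans (ler_normD _ _)) // lerD // DD.
have wB s t : `|s| <= T -> `|t| <= T -> `|w s - w t| <= B * `|s - t|.
  move=> sT tT; rewrite -subr_le0; apply: (@geometric_half_le0 (4 * C)) => k.
  have -> : w s - w t = (w s - U k s) - (w t - U k t) + (U k s - U k t).
    by apply/rowP => i; rewrite !mxE; ring.
  rewrite lerBlDr (le_trans (ler_normD _ _)) // lerD ?(UB k).2 //.
  rewrite (le_trans (ler_normB _ _)) // (le_trans (lerD (wU k _ sT) (wU k _ tT))) //.
  lra.
(* The limit [w] is not yet known to be differentiable. One more Picard step yields the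
   differentiable curve [W], and [W] is within C / 2^k of [U k.+1], hence equal to [w]. *)
have [W [W0 dW]] := step w wB.
exists T, W; split=> // t tT.
suff -> : W t = w t by exact: dW.
apply/eqP; rewrite -subr_eq0 -normr_le0.
apply: (@geometric_half_le0 (2 * C)) => k.
have dg (s : R) : `|s| <= T ->
    is_derive s 1 (W - U k.+1) (f (w s) - f (U k s)).
  by move=> sT; have := dW s sT => ?; have := dU k s sT => ?; apply: is_deriveB.
have gB : 0 <= K * (2 * C * 2^-1 ^+ k) by rewrite !mulr_ge0 // ltW.
have H : `|(W t - U k.+1 t) - (W 0 - U k.+1 0)|
    <= K * (2 * C * 2^-1 ^+ k) * `|t - 0|.
  apply: (derive_bound_lipschitz_rV gB dg _ tT abs0).
  by move=> s sT; rewrite (le_trans (fK _ _)) // ler_pM2l // wU.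
rewrite (UB _).1 W0 subrr !subr0 in H.
rewrite -(subrKA (U k.+1 t)) (le_trans (ler_normD _ _)) //.
have {}H : `|W t - U k.+1 t| <= C * 2^-1 ^+ k.
  rewrite (le_trans H) //.
  rewrite (@le_trans _ _ (K * (2 * C * 2^-1 ^+ k) * T)) ?ler_wpM2l //.
  have -> : K * (2 * C * 2^-1 ^+ k) * T = (K * T) * 2 * C * 2^-1 ^+ k by ring.
  by rewrite KT mulVf ?mul1r.
have := wU k.+1 t tT; rewrite distrC => H'.
rewrite (le_trans (lerD H H')) // exprS; lra.
Qed.

End Picard.

Section LocalODE.
Context {R : realType}.

Lemma is_derive_comp_curve (V W : normedModType R) (u : R -> V) (f : V -> W)
    (t : R) (du : V) :
  is_derive t 1 u du -> differentiable f (u t) ->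
  is_derive t 1 (fun s => f (u s)) ('D_du f (u t)).
Proof.
move=> [/derivable1_diffP du1 du2] df.
have dfu : differentiable (f \o u) t by exact: differentiable_comp.
split; first exact: diff_derivable.
rewrite (_ : (fun s => f (u s)) = f \o u) // deriveE // diff_comp // deriveE //=.
by rewrite -du2 deriveE.
Qed.

Lemma is_derive_line n (c w : 'rV[R]_n) (t : R) :
  is_derive t 1 (fun s : R => c + s *: w) w.
Proof.
apply: is_derive_mx => i j.
have -> : (fun s : R => (c + s *: w) i j) = cst (c i j) + (w i j \*: id).
  by apply/funext => s; rewrite !mxE mulrC.
have idt : is_derive t 1 (w i j \*: id) (w i j *: (1 : R)) by exact: is_deriveZ.
have := is_deriveD (is_derive_cst (c i j) t 1) idt.
by rewrite add0r /GRing.scale/= mulr1.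
Qed.

Lemma derive_sum_delta (W : normedModType R) n (f : 'rV[R]_n -> W) p w :
  differentiable f p -> 'D_w f p = \sum_j w 0 j *: 'D_(delta_mx 0 j) f p.
Proof.
move=> df; rewrite deriveE // {1}(row_sum_delta w) linear_sum /=.
by apply: eq_bigr => j _; rewrite linearZ /= deriveE.
Qed.

Lemma derive_delta_norm_le (W : normedModType R) n (f : 'rV[R]_n -> W) p w :
  differentiable f p ->
  `|'D_w f p| <= (\sum_j `|'D_(delta_mx 0 j) f p|) * `|w|.
Proof.
move=> df; rewrite derive_sum_delta // (le_trans (ler_norm_sum _ _ _)) //.
rewrite mulr_suml ler_sum // => j _; rewrite normrZ mulrC ler_wpM2l //.
exact: rV_coord_norm_le.
Qed.

Context {n : nat}.
Implicit Types (f : 'rV[R]_n -> 'rV[R]_n) (x : 'rV[R]_n).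

Definition lipschitz_ball f x (r K : R) :=
  forall y z, `|y - x| <= r -> `|z - x| <= r -> `|f y - f z| <= K * `|y - z|.

(** By continuity the finitely many partial derivatives stay within 1 of their values at [x] on a
    small ball; this bounds every directional derivative there, and the mean value inequality on
    segments gives the Lipschitz constant. *)
Lemma C1_lipschitz_ball f (U : set 'rV[R]_n) x : open U -> U x ->
  (forall y, U y -> differentiable f y) ->
  (forall v, {for x, continuous (fun y => 'D_v f y)}) ->
  exists r K : R, [/\ 0 < r, 0 < K, (forall y, `|y - x| <= r -> U y) &
    lipschitz_ball f x r K].
Proof.
move=> oU Ux df cf.
have near_x : \forall y \near x, U y /\
    forall j, `|'D_(delta_mx 0 j) f x - 'D_(delta_mx 0 j) f y| <= 1.
  apply: filterI; first exact: open_nbhs_nbhs.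
  pose P j y := `|'D_(delta_mx 0 j) f x - 'D_(delta_mx 0 j) f y| <= 1.
  have Pj j : \forall y \near x, P j y.
    by have /cvgrPdist_le := cf (delta_mx 0 j); apply; exact: ltr01.
  exact: (@filter_forall _ _ P (nbhs x) _ Pj).
have [r r0 xr] : exists2 r : R, 0 < r & forall y, `|y - x| <= r -> U y /\
    forall j, `|'D_(delta_mx 0 j) f x - 'D_(delta_mx 0 j) f y| <= 1.
  move/nbhs_ballP: near_x => [e /= e0 xe]; exists (e / 2); first by rewrite divr_gt0.
  move=> y yx; apply: xe; rewrite -ball_normE /= distrC (le_lt_trans yx) //; lra.
pose K := \sum_j (`|'D_(delta_mx 0 j) f x| + 1).
have K0 : 0 <= K by apply: sumr_ge0 => j _; rewrite addr_ge0.
exists r, (K + 1); split => //; first by rewrite ltr_wpDl.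
  by move=> y /xr[].
(* The segment from [z] to [y] is run through from its midpoint [c] with half difference [w], for
   times in [-1, 1], to match the symmetric intervals of [derive_bound_lipschitz_rV]. *)
move=> y z yr zr; pose c := 2^-1 *: (y + z); pose w := 2^-1 *: (y - z).
have cw (t : R) : `|t| <= 1 -> `|c + t *: w - x| <= r.
  rewrite ler_norml => /andP[t1 t2].
  have -> : c + t *: w - x = ((1 + t) / 2) *: (y - x) + ((1 - t) / 2) *: (z - x).
    by apply/rowP => i; rewrite !mxE; field.
  rewrite (le_trans (ler_normD _ _)) //.
  rewrite [`|_ *: (y - x)|]normrZ [`|_ *: (z - x)|]normrZ.
  rewrite (ger0_norm (_ : 0 <= (1 + t) / 2)); last lra.
  rewrite (ger0_norm (_ : 0 <= (1 - t) / 2)); last lra.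
  nra.
have dh (t : R) : `|t| <= 1 ->
    is_derive t 1 (fun s => f (c + s *: w)) ('D_w f (c + t *: w)).
  move=> /cw/xr[/df dfp _].
  exact: (is_derive_comp_curve (is_derive_line c w t) dfp).
have hB (t : R) : `|t| <= 1 -> `|'D_w f (c + t *: w)| <= K * `|w|.
  move=> /cw/xr[/df dfp Dp].
  rewrite (le_trans (derive_delta_norm_le w dfp)) // ler_wpM2r // ler_sum // => j _.
  by rewrite -lerBlDl (le_trans (lerB_dist _ _)) // distrC Dp.
have := @derive_bound_lipschitz_rV _ _ _ _ _ _ _ dh hB 1 (-1).
rewrite mulr_ge0 // normrN normr1 lexx => /(_ isT isT isT).
have -> : c + 1 *: w = y by apply/rowP => i; rewrite !mxE; field.
have -> : c + (-1) *: w = z by apply/rowP => i; rewrite !mxE; field.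
move=> H; apply: le_trans H _.
rewrite (ger0_norm (_ : 0 <= 1 - (-1) :> R)); last lra.
rewrite /w normrZ ger0_norm; last lra.
have := normr_ge0 (y - z); nra.
Qed.

(* Clamping each coordinate to the box of radius [r] makes [f] bounded and globally
   Lipschitz without changing it on the box. *)
Lemma picard_local f x (r K : R) : 0 < r -> 0 < K -> lipschitz_ball f x r K ->
  exists (T : R) (u : R -> 'rV[R]_n), [/\ 0 < T, u 0 = x &
    forall t : R, `|t| <= T -> `|u t - x| <= r /\ is_derive t 1 u (f (u t))].
Proof.
move=> r0 K0 fK; pose cl (y : 'rV[R]_n) := \row_i clamp (x 0 i) r (y 0 i).
have clr y : `|cl y - x| <= r.
  apply: rV_norm_le => [|i]; first exact: ltW.
  by rewrite !mxE clamp_near // ltW.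
have clid y : `|y - x| <= r -> cl y = y.
  move=> yr; apply/rowP => i; rewrite mxE clamp_id //.
  by rewrite (le_trans _ yr) //; have := rV_coord_norm_le (y - x) i; rewrite !mxE.
have cl1 y z : `|cl y - cl z| <= `|y - z|.
  apply: rV_norm_le => // i; rewrite !mxE.
  rewrite (le_trans (clamp_lipschitz _ _ _ (ltW r0))) //.
  by have := rV_coord_norm_le (y - z) i; rewrite !mxE.
pose B := `|f x| + K * r.
have B0 : 0 <= B by rewrite addr_ge0 // mulr_ge0 // ltW.
have fB y : `|f (cl y)| <= B.
  rewrite -[f (cl y)](subrK (f x)) addrC (le_trans (ler_normD _ _)) // lerD2l.
  have xx : `|x - x| <= r by rewrite subrr normr0 ltW.
  by rewrite (le_trans (fK _ _ (clr y) xx)) // ler_pM2l.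
have [|T [u [T0 u0 du]]] := picard_bounded x K0 fB.
  by move=> y z; rewrite (le_trans (fK _ _ (clr y) (clr z))) // ler_pM2l.
(* The speed is at most [B], so the curve cannot leave the ball of radius [r] before time r / (B +
   1); adding 1 keeps the denominator positive. *)
pose T' := Num.min T (r / (B + 1)).
have B1 : 0 < B + 1 by rewrite ltr_wpDl.
exists T', u; split => //; first by rewrite lt_min T0 divr_gt0.
move=> t; rewrite le_min => /andP[tT tr].
have utr : `|u t - x| <= r.
  have := @derive_bound_lipschitz_rV _ _ _ _ _ _ B0 du _ t 0 tT.
  rewrite normr0 ltW // u0 subr0 => H.
  apply: le_trans (H _ isT) _ => [s sT|]; first exact: fB.
  move: tr; rewrite ler_pdivlMr // => tr; rewrite mulrC (le_trans _ tr) //.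
  by rewrite ler_wpM2l // lerDl.
by split=> //; have := du t tT; rewrite clid.
Qed.

(** On so short an interval no Gronwall estimate is needed: the maximum M of |u - v| satisfies M <=
    K T M with K T < 1, hence M = 0. *)
Lemma ode_unique f (C : set 'rV[R]_n) (K T : R) (u v : R -> 'rV[R]_n) :
  0 <= K -> K * T < 1 ->
  (forall y z, C y -> C z -> `|f y - f z| <= K * `|y - z|) ->
  (forall t : R, `|t| <= T -> C (u t) /\ is_derive t 1 u (f (u t))) ->
  (forall t : R, `|t| <= T -> C (v t) /\ is_derive t 1 v (f (v t))) ->
  u 0 = v 0 -> forall t, `|t| <= T -> u t = v t.
Proof.
move=> K0 KT fK du dv uv0 t tT.
have T0 : 0 <= T by rewrite (le_trans _ tT).
have abs0 : `|0 : R| <= T by rewrite normr0.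
have dw (s : R) : `|s| <= T -> is_derive s 1 (u - v) (f (u s) - f (v s)).
  by move=> sT; have [_ ?] := du s sT; have [_ ?] := dv s sT; apply: is_deriveB.
have itvP s : s \in `[-T, T] -> `|s| <= T by rewrite in_itv/= ler_norml.
have [||c /itvP cT cmax] := @EVT_max R (fun s => `|u s - v s|) (- T) T.
- by rewrite (le_trans _ T0) // oppr_le0.
- have cw : {within `[- T, T], continuous (u - v)}.
    by apply: derivable_within_continuous => s /itvP/dw[].
  move=> s; apply: (@continuous_comp (subspace `[- T, T]) _ _ (u - v) Num.norm).
    exact: cw.
  exact: norm_continuous.
- set M := `|u c - v c| in cmax.
  have M0 : 0 <= M by exact: normr_ge0.
  have wM s : `|s| <= T -> `|u s - v s| <= M.
    by rewrite ler_norml => sT; apply: cmax; rewrite in_itv.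
  have KM : 0 <= K * M by rewrite mulr_ge0.
  have : `|(u c - v c) - (u 0 - v 0)| <= K * M * `|c - 0|.
    apply: (derive_bound_lipschitz_rV KM dw _ cT abs0) => s sT.
    have [Cu _] := du s sT; have [Cv _] := dv s sT.
    by rewrite (le_trans (fK _ _ Cu Cv)) // ler_wpM2l // wM.
  rewrite uv0 subrr !subr0 -/M => MK.
  have M0' : M = 0.
    apply/eqP; rewrite eq_le M0 andbT leNgt; apply/negP => Mgt0.
    have : M * (K * T) < M * 1 by rewrite ltr_pM2l.
    have : K * M * `|c| <= K * M * T by rewrite ler_wpM2l.
    lra.
  by apply/eqP; rewrite -subr_eq0 -normr_le0 -M0' wM.
Qed.

End LocalODE.

(** * Functions of class C^k *)

Section Ck.
Context {R : realType}.

(** The difference [g - f] vanishes near [x], so it has the zero map as differential there. *)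
Lemma near_eq_differentiable (V W : normedModType R) (f g : V -> W) x :
  (\near x, f x = g x) -> differentiable f x -> differentiable g x.
Proof.
move=> fg df; have -> : g = f + (g - f) by rewrite addrC subrK.
apply: differentiableD => //; set h := g - f.
have L0 : 'd (cst (0 : W)) x = 0 :> (V -> W) by rewrite diff_cst.
have Lc : continuous ('d (cst (0 : W)) x) by apply: diff_continuous.
have h0 : h \o shift x = cst (h x) + 'd (cst (0 : W)) x +o_ 0 id.
  rewrite L0; apply/eqaddoP => e e0; have := fg; rewrite (near_shift 0) subr0 => fg0.
  near=> y; rewrite !fctE /h !fctE.
  rewrite -(nbhs_singleton fg) subrr.
  have -> : f (y + x) = g (y + x) by near: y.
  by rewrite subrr !addr0 subr0 normr0 mulr_ge0 // ltW.
apply/diff_locallyP; rewrite (diff_unique Lc h0); split => //.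
Unshelve. all: by end_near. Qed.

Implicit Types V W : normedModType R.

(** Functions are total but meaningful on [D] only. Openness of [D] makes derivatives at its points
    depend on values in [D] alone, so a formula for a derivative valid just on [D] may be
    substituted at each order. *)
Lemma Ck_eq V W k (D : set V) (f g : V -> W) : open D ->
  (forall x, D x -> f x = g x) -> Ck k D f -> Ck k D g.
Proof.
move=> oD; elim: k f g => [|k IH] f g fg /=.
  move=> cf x Dx; change (g y @[y --> x] --> g x); rewrite -(fg x Dx).
  apply: cvg_trans (cf x Dx); apply: near_eq_cvg.
  by near=> y; apply: fg; near: y; exact: open_nbhs_nbhs.
have fgn x : D x -> \near x, f x = g x.
  by move=> Dx; near=> y; apply: fg; near: y; exact: open_nbhs_nbhs.
move=> [df Cf]; split=> [x Dx|v]; first exact: near_eq_differentiable (fgn x Dx) (df x Dx).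
by apply: IH (Cf v) => x Dx; apply: near_eq_derive; exact: fgn.
Unshelve. all: by end_near. Qed.

Lemma CkW V W k (D : set V) (f : V -> W) : Ck k.+1 D f -> Ck k D f.
Proof.
elim: k f => [f [df _] x /df/differentiable_continuous//|k IH f [df Cf]].
by split=> // v; apply: IH; exact: Cf.
Qed.

Lemma Ck_cst V W k (D : set V) (c : W) : Ck k D (cst c).
Proof.
elim: k c => [|k IH] c; first by move=> x _; exact: cvg_cst.
split=> // v; rewrite (_ : (fun x => 'D_v (cst c) x) = cst 0) //.
by apply/funext => x; rewrite derive_cst.
Qed.

Lemma CkD V W k (D : set V) (f g : V -> W) : open D ->
  Ck k D f -> Ck k D g -> Ck k D (fun x => f x + g x).
Proof.
move=> oD; elim: k f g => [|k IH] f g /=.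
  by move=> cf cg x Dx; apply: cvgD; [exact: cf | exact: cg].
move=> [df Cf] [dg Cg]; split=> [x Dx|v].
  by apply: differentiableD; [exact: df | exact: dg].
apply: Ck_eq (IH _ _ (Cf v) (Cg v)) => // x Dx.
by rewrite -deriveD //; apply: diff_derivable; [exact: df | exact: dg].
Qed.

Lemma Ck_sum V W k (D : set V) n (f : 'I_n -> V -> W) : open D ->
  (forall i, Ck k D (f i)) -> Ck k D (fun x => \sum_i f i x).
Proof.
move=> oD Cf; elim: n f Cf => [|n IH] f Cf.
  by apply: Ck_eq (@Ck_cst V W k D 0) => // x _; rewrite big_ord0.
apply: (@Ck_eq _ _ _ _ (fun x => \sum_(i < n) f (widen_ord (leqnSn n) i) x + f ord_max x)) => //.
  by move=> x _; rewrite big_ord_recr.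
by apply: CkD => //; apply: IH.
Qed.

Lemma CkM V k (D : set V) (f g : V -> R) : open D ->
  Ck k D f -> Ck k D g -> Ck k D (fun x => f x * g x).
Proof.
move=> oD; elim: k f g => [|k IH] f g.
  by move=> cf cg x Dx; apply: cvgM; [exact: cf | exact: cg].
move=> Cf Cg; have [df Df] := Cf; have [dg Dg] := Cg; split=> [x Dx|v].
  by apply: differentiableM; [exact: df | exact: dg].
apply: (@Ck_eq _ _ _ _ (fun x => f x * 'D_v g x + g x * 'D_v f x)) => //.
  move=> x Dx; rewrite deriveM //; apply: diff_derivable; [exact: df | exact: dg].
have Cf' := CkW Cf; have Cg' := CkW Cg.
apply: CkD => //; [exact: IH Cf' (Dg v) | exact: IH Cg' (Df v)].
Qed.

Lemma CkZ V W k (D : set V) (f : V -> W) a : open D ->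
  Ck k D f -> Ck k D (fun x => a *: f x).
Proof.
move=> oD; elim: k f => [|k IH] f.
  move=> cf x Dx; apply: (@continuous_comp _ _ _ f ( *:%R a)); first exact: cf.
  exact: scaler_continuous.
move=> [df Cf]; split=> [x Dx|v]; first by apply: differentiableZ; exact: df.
apply: (Ck_eq oD _ (IH _ (Cf v))) => x Dx.
by rewrite -deriveZ //; apply: diff_derivable; exact: df.
Qed.

Lemma Ck_coord V k (D : set V) m n (f : V -> 'M[R]_(m, n)) i j : open D ->
  Ck k D f -> Ck k D (fun x => f x i j : R).
Proof.
move=> oD; elim: k f => [|k IH] f.
  move=> cf x Dx; apply: (@continuous_comp _ _ _ f (fun M => M i j)); first exact: cf.
  exact: coord_continuous.
move=> [df Cf]; split=> [x Dx|v].
  apply: (@differentiable_comp _ _ _ _ f (fun M => M i j)); first exact: df.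
  exact: differentiable_coord.
apply: Ck_eq (IH _ (Cf v)) => // x Dx.
by rewrite derive_mx ?mxE //; apply: diff_derivable; exact: df.
Qed.

Lemma Ck_derive V W k (D : set V) (f : V -> W) v :
  Ck k.+1 D f -> Ck k D (fun x => 'D_v f x).
Proof. by move=> [_]; apply. Qed.

Lemma smooth_differentiable V W (D : set V) (f : V -> W) x :
  smooth_on D f -> D x -> differentiable f x.
Proof. by move=> /(_ 1%N)[df _] /df. Qed.

Lemma Ck_id V k (D : set V) : Ck k D id.
Proof.
case: k => [|k]; first by move=> x _; exact: cvg_id.
split=> [//|v]; rewrite (_ : (fun x => 'D_v id x) = cst v); first exact: Ck_cst.
by apply/funext => x; rewrite derive_id.
Qed.

(* One derivative is lost because the continuity of [u] is derived from the
   differentiability of its coordinates. *)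
Lemma Ck_rV n k (D : set R^o) (u : R^o -> 'rV[R]_n) : open D ->
  (forall i, Ck k.+1 D (fun t => u t 0 i : R)) -> Ck k D u.
Proof.
move=> oD; elim: k u => [|k IH] u Cu.
  move=> t Dt; apply: differentiable_continuous; apply/derivable1_diffP.
  apply/derivable_mxP => i j; rewrite (ord1 i); apply/derivable1_diffP.
  by have [du _] := Cu j; exact: du.
have du t : D t -> differentiable u t.
  move=> Dt; apply/derivable1_diffP.
  apply/derivable_mxP => i j; rewrite (ord1 i); apply/derivable1_diffP.
  by have [du _] := Cu j; exact: du.
split=> // v; apply: IH => i; have Ci := Ck_derive v (Cu i).
apply: (Ck_eq oD _ Ci) => t Dt.
by rewrite derive_mx ?mxE //; apply: diff_derivable; exact: du.
Qed.

Section IntegralCurve.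
Context {n : nat} (U : set 'rV[R]_n) (f : 'rV[R]_n -> 'rV[R]_n).
Context (D : set R^o) (u : R^o -> 'rV[R]_n).
Hypotheses (oU : open U) (oD : open D) (sf : smooth_on U f).
Hypotheses (uU : forall t, D t -> U (u t)).
Hypotheses (du : forall t, D t -> is_derive t 1 u (f (u t))).

(* Bootstrapping: the derivative of g o u is (D_f g) o u, where D_f g is smooth. *)
Lemma smooth_comp_integral_curve k (g : 'rV[R]_n -> R) : smooth_on U g ->
  Ck k D (fun t => g (u t)).
Proof.
elim: k g => [|k IH] g sg.
  move=> t Dt; apply: continuous_comp.
    exact: (is_derive1_continuous (du Dt)).
  apply: differentiable_continuous.
  by apply: smooth_differentiable sg _; exact: uU.
have dgu t : D t -> is_derive t 1 (fun s => g (u s)) ('D_(f (u t)) g (u t)).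
  move=> Dt; apply: is_derive_comp_curve; first exact: du.
  by apply: smooth_differentiable sg _; exact: uU.
have dgu' t : D t -> differentiable (fun s => g (u s)) t.
  by move=> /dgu[/derivable1_diffP].
split=> [//|v].
(* Directions in the time line are the scalars [v], and the derivative in direction [v] is [v] times
   the one in direction 1; hence the factor. *)
pose h x := v * \sum_i f x 0 i * 'D_(delta_mx 0 i) g x.
apply: (@Ck_eq _ _ _ _ (fun t => h (u t))) => // [t Dt|].
  rewrite deriveE; last exact: dgu'.
  rewrite -[v in RHS]mulr1 [RHS]linearZ /= -deriveE; last exact: dgu'.
  rewrite (@derive_val _ _ _ _ _ _ _ (dgu t Dt)) derive_sum_delta //.
  by apply: smooth_differentiable sg _; exact: uU.
apply: IH => m; apply: CkM => //; first exact: Ck_cst.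
apply: Ck_sum => // i; apply: CkM => //; first exact: Ck_coord.
exact: Ck_derive.
Qed.

Lemma smooth_integral_curve : smooth_on D u.
Proof.
move=> k; apply: Ck_rV => // i; apply: (@smooth_comp_integral_curve _ (fun x => x 0 i)).
by move=> m; apply: Ck_coord => //; exact: Ck_id.
Qed.

End IntegralCurve.

End Ck.

(** * One-parameter subgroups *)

Section LocalHomomorphism.
Context {R : realType} {H : groupType}.
Implicit Types (g : R -> H) (e : R).

Lemma local_hom_natmul g e : g 0 = 1%g ->
  (forall s t : R, `|s| <= e -> `|t| <= e -> `|(s + t)| <= e ->
    g (s + t) = (g s * g t)%g) ->
  forall m (t : R), (m%:R * `|t| <= e) -> g (m%:R * t) = (g t ^+ m)%g.
Proof.
move=> g0 gD m t; have e0 (k : nat) : (0 <= k%:R * `|t|) by rewrite mulr_ge0.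
elim: m => [|m IH] mt; first by rewrite mul0r g0 expg0.
have mt' : (m%:R * `|t| <= e).
  by rewrite (le_trans _ mt) // ler_wpM2r // ler_nat.
rewrite expgSr -IH // -natr1 mulrDl mul1r gD //.
- by rewrite normrM normr_nat.
- by rewrite (le_trans _ mt) // -natr1 mulrDl mul1r lerDr.
- by rewrite -{2}[t]mul1r -mulrDl natr1 normrM normr_nat.
Qed.

(** The extension is g (t / N) ^ N for any N with |t| <= e N. Two admissible exponents agree through
    their product, and for a common exponent m the elements g (s / m) and g (t / m) commute, both
    products being g ((s + t) / m), so that powers multiply. *)
Lemma local_hom_extension g e : (0 < e) -> g 0 = 1%g ->
  (forall s t : R, `|s| <= e -> `|t| <= e -> `|(s + t)| <= e ->
    g (s + t) = (g s * g t)%g) ->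
  exists h : R -> H, (forall s t, h (s + t) = (h s * h t)%g) /\
    (forall t, (`|t| <= e) -> h t = g t).
Proof.
move=> e0 g0 gD; have gM := local_hom_natmul g0 gD.
pose N (t : R) := (Num.truncn (`|t| / e)).+1.
pose h t := (g (t / (N t)%:R)%R ^+ N t)%g.
have N0 (m : nat) : (0 < m)%N -> (0 < m%:R :> R) by rewrite ltr0n.
have NP t : (`|t| <= e * (N t)%:R).
  by rewrite mulrC -ler_pdivrMr // ltW // truncnS_gt.
have hE m t : (0 < m)%N -> (`|t| <= e * m%:R) -> h t = (g (t / m%:R)%R ^+ m)%g.
  have key a b (s : R) : (0 < a)%N -> (0 < b)%N -> (`|s| <= e * a%:R) ->
      (g (s / a%:R)%R ^+ a = g (s / (b * a)%:R)%R ^+ (b * a))%g.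
    move=> a0 b0 sa; have e1 : s / a%:R = b%:R * (s / (b * a)%:R).
      have an0 : a%:R != 0 :> R by rewrite gt_eqF ?N0.
      have bn0 : b%:R != 0 :> R by rewrite gt_eqF ?N0.
      by rewrite natrM; field; rewrite an0 bn0.
    rewrite e1 gM ?expgnA //.
    by rewrite -[b%:R]normr_nat -normrM -e1 normrM normfV normr_nat ler_pdivrMr ?N0.
  move=> m0 tm; rewrite /h (key _ m) // ?NP // (key m (N t)) // mulnC //.
exists h; split; last by move=> t te; rewrite (hE 1%N) ?mulr1 // divr1 expg1.
move=> s t; pose m := (N s + N t + N (s + t)%R)%N.
have m0 : (0 < m)%N by rewrite /m addnS.
have le_m (x : R) : (N x <= m)%N -> (`|x| <= e * m%:R).
  by move=> xm; apply: (le_trans (NP x)); apply: ler_wpM2l; [exact: ltW | rewrite ler_nat].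
have sm : (`|s| <= e * m%:R) by apply: le_m; rewrite /m -addnA leq_addr.
have tm : (`|t| <= e * m%:R) by apply: le_m; rewrite /m addnAC leq_addl.
have stm : (`|(s + t)| <= e * m%:R) by apply: le_m; rewrite /m leq_addl.
have small (x : R) : (`|x| <= e * m%:R) -> (`|x / m%:R| <= e).
  by move=> xm; rewrite normrM normfV normr_nat ler_pdivrMr // N0.
have gst : g ((s + t) / m%:R) = (g (s / m%:R)%R * g (t / m%:R)%R)%g.
  by rewrite mulrDl gD ?small // -mulrDl small.
have gts : g ((s + t) / m%:R) = (g (t / m%:R)%R * g (s / m%:R)%R)%g.
  by rewrite addrC mulrDl gD ?small // -mulrDl small // addrC.
rewrite !(hE m) // gst expgMn // /commute -gst gts //.
Qed.

Lemma hom_natmul (h : R -> H) : (forall s t, h (s + t) = (h s * h t)%g) ->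
  forall m t, h (m%:R * t) = (h t ^+ m)%g.
Proof.
move=> hD; have h0 : h 0 = 1%g.
  by apply: (@mulgI _ (h 0)); rewrite -hD mulg1 addr0.
elim=> [|m IH] t; first by rewrite mul0r h0 expg0.
by rewrite -natr1 mulrDl mul1r hD IH expgSr.
Qed.

(** The value at [t] is a power of the value at t / N, which lies in the interval of agreement. *)
Lemma hom_eq (g h : R -> H) e : (0 < e) ->
  (forall s t, g (s + t) = (g s * g t)%g) -> (forall s t, h (s + t) = (h s * h t)%g) ->
  (forall t, (`|t| <= e) -> g t = h t) -> forall t, g t = h t.
Proof.
move=> e0 gD hD gh t; pose N := (Num.truncn (`|t| / e)).+1.
have N0 : (0 < N%:R :> R) by rewrite ltr0n.
have -> : (t = N%:R * (t / N%:R)) by rewrite mulrC mulfVK ?gt_eqF.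
rewrite (hom_natmul gD) (hom_natmul hD) gh // normrM normfV normr_nat.
by rewrite ler_pdivrMr // mulrC -ler_pdivrMr // ltW // truncnS_gt.
Qed.

End LocalHomomorphism.

Section Charts.
Context {R : realType} {n : nat} {M : manifoldType R n}.
Implicit Types (phi psi : chart R n M) (p : M).

Lemma cimg_open phi : atlas phi -> open (cimg phi).
Proof. by move=> /atlas_chart[]. Qed.

Lemma cdom_open phi : atlas phi -> open (cdom phi).
Proof. by move=> /atlas_chart[]. Qed.

Lemma cmapK phi p : chart_at p phi -> cinv phi (phi p) = p.
Proof. by move=> [/atlas_chart[_ _ + _ _]]; apply. Qed.

Lemma chart_cimg phi p : chart_at p phi -> cimg phi (phi p).
Proof. by move=> [_ pphi]; exists p. Qed.

Lemma cinv_chart_at phi u : atlas phi -> cimg phi u -> chart_at (cinv phi u) phi.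
Proof. by move=> aphi [p pphi <-]; split=> //; rewrite cmapK. Qed.

Lemma cinvK phi u : atlas phi -> cimg phi u -> phi (cinv phi u) = u.
Proof. by move=> aphi [p pphi <-]; rewrite cmapK. Qed.

Lemma cmap_continuous phi p : chart_at p phi -> {for p, continuous (cmap phi)}.
Proof. by move=> [/atlas_chart[_ _ _ + _]]; apply. Qed.

Lemma cinv_continuous phi u : atlas phi -> cimg phi u -> {for u, continuous (cinv phi)}.
Proof. by move=> /atlas_chart[_ _ _ _ +]; apply. Qed.

Lemma nbhs_cdom phi p : chart_at p phi -> nbhs p (cdom phi).
Proof. by move=> [aphi pphi]; apply: open_nbhs_nbhs; split => //; exact: cdom_open. Qed.

Lemma chart_exists p : exists phi, chart_at p phi.
Proof. by have [phi ? ?] := atlas_cover p; exists phi. Qed.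

End Charts.

Section LeftTranslation.
Context {R : realType} {n : nat} {G : lieGroupType R n}.
Implicit Types (phi psi : chart R n G) (p h : G) (Y : vfield G).

(** Left translation is the restriction of the jointly smooth multiplication to the slice where the
    first factor has the coordinates of [h]. *)
Lemma mulg_chart_differentiable h p phi psi :
  chart_at p phi -> chart_at (h * p)%g psi ->
  differentiable (fun u => psi (h * cinv phi u)%g) (phi p).
Proof.
move=> pphi hpsi; have [chi hchi] := chart_exists h.
have sm := lie_mulg_smooth _ _ _ hchi.1 pphi.1 hpsi.1.
have df : differentiable (fun uv : 'rV[R]_n * 'rV[R]_n =>
    psi (cinv chi uv.1 * cinv phi uv.2)%g) (chi h, phi p).
  apply: smooth_differentiable sm _ => /=; rewrite !cmapK //.
  by split; [exact: chart_cimg | exact: chart_cimg | exact: hpsi.2].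
have : differentiable ((fun uv : 'rV[R]_n * 'rV[R]_n =>
    psi (cinv chi uv.1 * cinv phi uv.2)%g) \o (fun u => (chi h, u))) (phi p).
  by apply: differentiable_comp => //; exact: differentiable_pair.
by rewrite (_ : _ \o _ = fun u => psi (h * cinv phi u)%g) //; apply/funext => u /=; rewrite cmapK.
Qed.

(** The chain rule for left translation turns the velocity into its image under [dmap], which
    invariance identifies with the field at the translated point. The curve has to stay in the chart
    near [t] for [cinv phi] to undo [phi] there. *)
Lemma translate_is_derive Y (gamma : R -> G) h (t : R) phi psi :
  left_invariant Y -> chart_at (gamma t) phi -> chart_at (h * gamma t)%g psi ->
  (\forall s \near t, cdom phi (gamma s)) ->
  is_derive t 1 (fun s => phi (gamma s)) (Y (gamma t) phi) ->
  is_derive t 1 (fun s => psi (h * gamma s)%g) (Y (h * gamma t)%g psi).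
Proof.
move=> [_ LY] cphi cpsi near_dom dgamma.
have := is_derive_comp_curve dgamma (mulg_chart_differentiable cphi cpsi).
rewrite (LY _ _ phi _ cphi cpsi); apply: near_eq_is_derive; near=> s => /=.
by rewrite cmapK //; split; [exact: cphi.1 | near: s].
Unshelve. all: by end_near. Qed.

Lemma left_invariantZ Y a : left_invariant Y -> left_invariant (a *: Y).
Proof.
move=> [[Y0 Yc Ys] LY].
have linD h p phi psi v : chart_at p phi -> chart_at (h * p)%g psi ->
    dmap (fun q => h * q)%g phi psi p (a *: v) =
    a *: dmap (fun q => h * q)%g phi psi p v.
  move=> cp ch; have df := mulg_chart_differentiable cp ch.
  by rewrite /dmap !deriveE // linearZ.
have scE p phi : (a *: Y) p phi = a *: Y p phi by [].
split; last by move=> h p phi psi cp ch; rewrite !scE (LY _ _ _ _ cp ch) linD.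
split.
- by move=> p phi /Y0; rewrite scE => ->; rewrite scaler0.
- move=> p phi psi cp cs; rewrite !scE (Yc _ _ _ cp cs).
  (* A change of coordinates is translation by the identity, so its linearity is the case
     [h = 1]. *)
  have := linD 1%g p phi psi (Y p phi) cp; rewrite mul1g => /(_ cs).
  by rewrite (_ : (fun q => 1 * q)%g = id) //; apply/funext => q; rewrite mul1g.
- by move=> phi aphi k; exact: (CkZ a (cimg_open aphi) (Ys phi aphi k)).
Qed.

Section Homomorphism.
Context (Y : vfield G) (gamma : R -> G).
Hypotheses (LY : left_invariant Y).
Hypothesis gammaD : forall s t, gamma (s + t) = (gamma s * gamma t)%g.

Lemma hom0 : gamma 0 = 1%g.
Proof. by apply: (@mulgI _ (gamma 0)); rewrite -gammaD mulg1 addr0. Qed.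

Lemma hom_shift_cvg t : {for 0, continuous gamma} ->
  gamma (s - t) @[s --> t] --> 1%g.
Proof.
move=> c0; rewrite -hom0.
apply: (@cvg_comp _ _ _ (fun s => s - t) gamma (nbhs t) (nbhs (0 : R))).
  by rewrite -(subrr t); apply: cvgB; [exact: cvg_id | exact: cvg_cst].
exact: c0.
Qed.

Lemma hom_continuous : {for 0, continuous gamma} -> continuous gamma.
Proof.
move=> c0 t; have e : gamma = (fun s => gamma t * gamma (s - t))%g.
  by apply/funext => s; rewrite -gammaD addrC subrK.
have c1 := @hom_shift_cvg t c0.
have : (gamma t * gamma (s - t))%g @[s --> t] --> (gamma t * 1)%g.
  apply: (@cvg_comp _ _ _ (fun s => (gamma t, gamma (s - t))) (fun pq : G * G => pq.1 * pq.2)%g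
    _ (nbhs (gamma t, 1%g))); last exact: (lie_mulg_continuous (gamma t, 1%g)).
  by apply: cvg_pair => //; exact: cvg_cst.
by rewrite mulg1 -e.
Qed.

(** Writing gamma s = gamma t * gamma (s - t) transports the velocity at the identity to every other
    time by left translation. *)
Lemma hom_is_derive phi : chart_at 1%g phi -> {for 0, continuous gamma} ->
  is_derive (0 : R) 1 (fun s => phi (gamma s)) (Y 1%g phi) ->
  forall t psi, chart_at (gamma t) psi ->
    is_derive t 1 (fun s => psi (gamma s)) (Y (gamma t) psi).
Proof.
move=> cphi c0 d0 t psi cpsi.
have e : gamma = (fun s => gamma t * gamma (s - t))%g.
  by apply/funext => s; rewrite -gammaD addrC subrK.
have gt0 : gamma (t - t) = 1%g by rewrite subrr hom0.
have -> : (fun s => psi (gamma s)) = (fun s => psi (gamma t * gamma (s - t))%g).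
  by apply/funext => s; rewrite {1}e.
have -> : Y (gamma t) psi = Y (gamma t * gamma (t - t))%g psi by rewrite gt0 mulg1.
apply: (@translate_is_derive Y (fun s => gamma (s - t)) _ t phi) => //.
- by rewrite gt0.
- by rewrite gt0 mulg1.
- by have /(_ _ (nbhs_cdom cphi)) := @hom_shift_cvg t c0.
- rewrite gt0; have ds : is_derive t 1 (fun s : R => s - t) 1.
    have -> : (fun s : R => s - t) = id - cst t by [].
    by apply: is_derive_eq; rewrite subr0.
  have := @is_derive_comp_curve _ _ _ _ (fun s => phi (gamma s)) t 1 ds.
  rewrite subrr; have [d1 d2] := d0; rewrite d2; apply.
  exact/derivable1_diffP.
Qed.

(** Smoothness need not be assumed: the homomorphism is an integral curve of the smooth field [Y],
    and integral curves are smooth. *)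
Lemma hom_one_param_subgroup phi : chart_at 1%g phi -> {for 0, continuous gamma} ->
  is_derive (0 : R) 1 (fun s => phi (gamma s)) (Y 1%g phi) ->
  one_param_subgroup Y gamma.
Proof.
move=> cphi c0 d0; have cg := hom_continuous c0; have dg := hom_is_derive cphi c0 d0.
split=> //; last first.
  move=> psi cpsi; rewrite derive1E -hom0; have := dg 0 psi; rewrite hom0.
  by move=> /(_ cpsi)[_ ->].
split=> // psi apsi.
apply: (@smooth_integral_curve _ _ (cimg psi) (fun u => Y (cinv psi u) psi)).
- exact: cimg_open.
- by move: cg => /continuousP; apply; exact: cdom_open.
- by have [[_ _ +] _] := LY; apply.
- by move=> t ct; exists (gamma t).
- by move=> t ct; rewrite cmapK //; apply: dg.
Qed.

End Homomorphism.

Lemma one_param_subgroup_is_derive Y gamma : left_invariant Y ->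
  one_param_subgroup Y gamma ->
  forall t psi, chart_at (gamma t) psi ->
    is_derive t 1 (fun s => psi (gamma s)) (Y (gamma t) psi).
Proof.
move=> LY [[cg sg] gD dg]; have [phi cphi] := chart_exists (1%g : G).
apply: (hom_is_derive LY gD cphi); first exact: cg.
rewrite -(dg phi cphi) derive1E; apply: derivableP; apply/derivable1_diffP.
have /= sphi := sg phi cphi.1.
by apply: (smooth_differentiable sphi); rewrite /= (hom0 gD); exact: cphi.2.
Qed.

End LeftTranslation.

(** * Existence and uniqueness of one-parameter subgroups, and the exponential map *)

Section Exponential.
Context {R : realType} {n : nat} {G : lieGroupType R n}.
Implicit Types (phi psi : chart R n G) (Y : vfield G) (gamma delta : R -> G).

(** The quantitative conditions under which both [picard_local] and [ode_unique] apply around the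
    identity; away from it, left translation takes over. *)
Definition flow_box Y phi (r K : R) :=
  [/\ chart_at 1%g phi, 0 < r, 0 < K,
      forall u, `|u - phi 1%g| <= r -> cimg phi u &
      lipschitz_ball (fun u => Y (cinv phi u) phi) (phi 1%g) r K].

Lemma flow_box_exists Y : left_invariant Y -> exists phi r K, flow_box Y phi r K.
Proof.
move=> [[_ _ sY] _]; have [phi cphi] := chart_exists (1%g : G).
have sf := sY phi cphi.1.
have [|v|r [K [r0 K0 rU fK]]] := C1_lipschitz_ball (cimg_open cphi.1) (chart_cimg cphi)
  (f := fun u => Y (cinv phi u) phi).
- by move=> y Uy; exact: smooth_differentiable sf Uy.
- by have [_ /(_ v) c] := sf 1%N; apply: c; exact: chart_cimg.
by exists phi, r, K.
Qed.

Definition in_flow_box phi (r : R) : set G :=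
  [set p | cdom phi p /\ `|phi p - phi 1%g| <= r].

Lemma nbhs_in_flow_box Y phi r K : flow_box Y phi r K -> nbhs 1%g (in_flow_box phi r).
Proof.
move=> [cphi r0 _ _ _]; apply: filterI; first exact: nbhs_cdom.
have /cvgrPdist_le/(_ r r0) := cmap_continuous cphi.
by apply: filterS => p; rewrite distrC.
Qed.

Lemma flow_box_unique Y phi r K (T : R) gamma delta : flow_box Y phi r K ->
  K * T < 1 ->
  (forall t : R, `|t| <= T -> in_flow_box phi r (gamma t) /\
    is_derive t 1 (fun s => phi (gamma s)) (Y (gamma t) phi)) ->
  (forall t : R, `|t| <= T -> in_flow_box phi r (delta t) /\
    is_derive t 1 (fun s => phi (delta s)) (Y (delta t) phi)) ->
  gamma 0 = delta 0 -> forall t, `|t| <= T -> gamma t = delta t.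
Proof.
move=> [cphi r0 K0 rU fK] KT dg dd gd0 t tT.
have box (h : R -> G) : (forall t : R, `|t| <= T -> in_flow_box phi r (h t) /\
    is_derive t 1 (fun s => phi (h s)) (Y (h t) phi)) ->
  forall t : R, `|t| <= T -> `|phi (h t) - phi 1%g| <= r /\
    is_derive t 1 (fun s => phi (h s)) (Y (cinv phi (phi (h t))) phi).
  move=> dh s sT; have [[dom hr] dhs] := dh s sT.
  by rewrite cmapK //; split => //; exact: cphi.1.
have : phi (gamma t) = phi (delta t).
  apply: (ode_unique (f := fun u => Y (cinv phi u) phi)
    (C := [set u | `|u - phi 1%g| <= r]) (ltW K0) KT _ (box _ dg) (box _ dd)) => //.
  by rewrite gd0.
have [[domg _] _] := dg t tT; have [[domd _] _] := dd t tT.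
move=> /(congr1 (cinv phi)); rewrite !cmapK //; split => //; exact: cphi.1.
Qed.

Lemma one_param_subgroup_unique Y gamma delta : left_invariant Y ->
  one_param_subgroup Y gamma -> one_param_subgroup Y delta -> gamma = delta.
Proof.
move=> LY og od; have [phi [r [K fb]]] := flow_box_exists LY.
have [cphi r0 K0 _ _] := fb.
have [[cg _] gD _] := og; have [[cd _] dD _] := od.
have nb (h : R -> G) : continuous h -> h 0 = 1%g ->
    \forall t \near (0 : R), in_flow_box phi r (h t).
  move=> ch h0; have := ch 0; rewrite /continuous_at h0; apply.
  exact: nbhs_in_flow_box fb.
have : \forall t \near (0 : R), in_flow_box phi r (gamma t) /\ in_flow_box phi r (delta t).
  by apply: filterI; apply: nb => //; exact: hom0.
move=> /nbhs_ballP[e0 /= e00 He].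
(* The first term keeps the closed interval inside the open ball of radius [e0], the second gives K
   e <= 1/2 for ODE uniqueness. *)
pose e := Num.min (e0 / 2) (K^-1 / 2).
have e_gt0 : 0 < e by rewrite lt_min !divr_gt0 // invr_gt0.
have ee0 (t : R) : `|t| <= e -> ball (0 : R) e0 t.
  rewrite le_min => /andP[te _]; rewrite -ball_normE /= sub0r normrN.
  by rewrite (le_lt_trans te) //; lra.
have Ke : K * e < 1.
  have : K * e <= K * (K^-1 / 2) by rewrite ler_pM2l // ge_min lexx orbT.
  rewrite mulrA mulfV ?gt_eqF //; lra.
apply/funext; apply: (hom_eq e_gt0 gD dD).
apply: (flow_box_unique fb Ke); last by rewrite (hom0 gD) (hom0 dD).
- move=> t te; have [bg _] := He t (ee0 t te); split => //.
  apply: (one_param_subgroup_is_derive LY og); split; [exact: cphi.1 | exact: bg.1].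
- move=> t te; have [_ bd] := He t (ee0 t te); split => //.
  apply: (one_param_subgroup_is_derive LY od); split; [exact: cphi.1 | exact: bd.1].
Qed.

Lemma local_flow_exists Y phi r K : flow_box Y phi r K ->
  exists (T : R) gamma, [/\ 0 < T, gamma 0 = 1%g, {for 0, continuous gamma} &
    forall t : R, `|t| <= T -> in_flow_box phi r (gamma t) /\
      is_derive t 1 (fun s => phi (gamma s)) (Y (gamma t) phi)].
Proof.
move=> [cphi r0 K0 rU fK]; have [T [u [T0 u0 du]]] := picard_local r0 K0 fK.
(* Differentiating at [t] requires the curve to remain in the chart for times around [t]; halving
   the interval keeps [t] interior to the original one. *)
have aphi := cphi.1; exists (T / 2), (fun t => cinv phi (u t)); split.
- by rewrite divr_gt0.
- by rewrite u0 cmapK.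
- have [|_ d0] := du 0; first by rewrite normr0 ltW.
  apply: continuous_comp; first exact: (is_derive1_continuous d0).
  by apply: cinv_continuous => //; rewrite u0; exact: chart_cimg.
- move=> t tT; have [|ur dut] := du t; first by rewrite (le_trans tT) //; lra.
  have Uu := rU _ ur; split.
    by split; [have [] := cinv_chart_at aphi Uu | rewrite cinvK].
  apply: near_eq_is_derive dut; near=> s; rewrite cinvK //; apply: rU.
  have [] // := du s; near: s.
  have : `|s| @[s --> t] --> `|t| by apply: cvg_norm; exact: cvg_id.
  by move=> /cvgr_le; apply; rewrite (le_lt_trans tT) //; lra.
Unshelve. all: by end_near. Qed.

Lemma one_param_subgroup_exists Y : left_invariant Y ->
  exists gamma, one_param_subgroup Y gamma.
Proof.
move=> LY; have [phi [r [K fb]]] := flow_box_exists LY.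
have [cphi r0 K0 _ _] := fb; have aphi := cphi.1.
have [T [g [T0 g0 cg dg]]] := local_flow_exists fb.
have : \forall p \near ((0 : R), (0 : R)), in_flow_box phi r (g p.1 * g p.2)%g.
  have : (g p.1 * g p.2)%g @[p --> ((0 : R), (0 : R))] --> (1 * 1 : G)%g.
    apply: (@cvg_comp _ _ _ (fun p : R * R => (g p.1, g p.2))
      (fun pq : G * G => pq.1 * pq.2)%g _ (nbhs (1%g, 1%g)));
      last exact: (lie_mulg_continuous (1%g, 1%g)).
    apply: cvg_pair; rewrite /= -g0.
      by apply: (@cvg_comp _ _ _ fst g _ (nbhs (0 : R))) => //; exact: cvg_fst.
    by apply: (@cvg_comp _ _ _ snd g _ (nbhs (0 : R))) => //; exact: cvg_snd.
  rewrite mulg1; apply; exact: nbhs_in_flow_box fb.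
move=> /nbhs_ballP[e0 /= e00 He].
(* The three terms ensure that s + t is still a time of the local flow, that g s * g t lies in the
   flow box, and that uniqueness applies. *)
pose e := Num.min (T / 2) (Num.min (e0 / 2) (K^-1 / 2)).
have e_gt0 : 0 < e by rewrite !lt_min !divr_gt0 // invr_gt0.
have eT (t : R) : `|t| <= e -> `|t| <= T / 2 by rewrite le_min => /andP[].
have ee0 (t : R) : `|t| <= e -> ball (0 : R) e0 t.
  rewrite !le_min => /and3P[_ te _]; rewrite -ball_normE /= sub0r normrN.
  by rewrite (le_lt_trans te) //; lra.
have Ke : K * e < 1.
  have : K * e <= K * (K^-1 / 2) by rewrite ler_pM2l // !ge_min lexx !orbT.
  rewrite mulrA mulfV ?gt_eqF //; lra.
have eT2 (t : R) : `|t| <= e -> `|t| <= T by move=> /eT; lra.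
(* As functions of t, both sides are integral curves of Y starting at g s. *)
have gD s t : `|s| <= e -> `|t| <= e -> g (s + t) = (g s * g t)%g.
  move=> se te; move: t te; apply: (flow_box_unique fb Ke).
  - move=> t te; have stT : `|s + t| <= T.
      by rewrite (le_trans (ler_normD _ _)) //; have := eT _ se; have := eT _ te; lra.
    have [box dst] := dg _ stT; split => //.
    have ds : is_derive t (1 : R) (fun x : R => s + x) 1.
      have -> : (fun x : R => s + x) = cst s + id by [].
      by apply: is_derive_eq; rewrite add0r.
    have [d1 d2] := dst; have df : differentiable (fun x => phi (g x)) (s + t).
      exact/derivable1_diffP.
    rewrite -d2; exact: (is_derive_comp_curve ds df).
  - move=> t te; have box := He (s, t) (conj (ee0 _ se) (ee0 _ te)).
    have [bt dt] := dg t (eT2 _ te); split => //.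
    apply: (translate_is_derive LY _ _ _ dt) => //.
    + by split => //; exact: bt.1.
    + by split => //; exact: box.1.
    + near=> x; suff /dg[[]] : `|x| <= T by []; near: x.
      have : `|s| @[s --> t] --> `|t| by apply: cvg_norm; exact: cvg_id.
      by move=> /cvgr_le; apply; have := eT _ te; lra.
  - by rewrite addr0 g0 mulg1.
have [h [hD hg]] := local_hom_extension e_gt0 g0 (fun s t se te _ => gD s t se te).
have hgn : \forall t \near (0 : R), g t = h t.
  apply/nbhs_ballP; exists e => // t; rewrite -ball_normE /= sub0r normrN => te.
  by rewrite hg // ltW.
exists h; apply: (hom_one_param_subgroup LY hD cphi).
  rewrite /prop_for /continuous_at hg ?normr0 ?ltW //.
  by apply: cvg_trans cg; apply: near_eq_cvg.
have [|_ d0] := dg 0; first by rewrite normr0 ltW.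
rewrite -g0; apply: near_eq_is_derive d0; near=> t.
by have -> : g t = h t by near: t.
Unshelve. all: by end_near. Qed.

Lemma one_param_subgroupZ Y gamma a : left_invariant Y ->
  one_param_subgroup Y gamma -> one_param_subgroup (a *: Y) (fun t => gamma (a * t)).
Proof.
move=> LY og; have [[cg _] gD _] := og; have [phi cphi] := chart_exists (1%g : G).
have da : is_derive (0 : R) 1 (fun s : R => a * s) a.
  have -> : (fun s : R => a * s) = a \*: id by [].
  by apply: is_derive_eq; rewrite /GRing.scale /= mulr1.
apply: (hom_one_param_subgroup (left_invariantZ a LY) _ cphi).
- by move=> s t; rewrite mulrDr gD.
- apply: (@continuous_comp _ _ _ (fun s : R => a * s) gamma); last exact: cg.
  exact: (is_derive1_continuous da).
- have g0 := hom0 gD.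
  have dg : is_derive (0 : R) 1 (fun s => phi (gamma s)) (Y 1%g phi).
    by rewrite -g0; apply: (one_param_subgroup_is_derive LY og); rewrite g0.
  have [d1 d2] := dg; have df : differentiable (fun s => phi (gamma s)) (0 : R).
    exact/derivable1_diffP.
  have e : 'D_a (fun s => phi (gamma s)) (0 : R) = (a *: Y) 1%g phi.
    have -> : (a *: Y) 1%g phi = a *: Y 1%g phi by [].
    by rewrite -d2 !deriveE // -linearZ /= [a *: _]mulr1.
  rewrite -e; have df' : differentiable (fun s => phi (gamma s)) (a * 0) by rewrite mulr0.
  by have := is_derive_comp_curve da df'; rewrite mulr0.
Qed.

(** [lie_exp (t *: Y)] is the time 1 value of the subgroup generated by [t *: Y]. By uniqueness this
    subgroup is s |-> gamma (t s), where gamma is generated by [Y], so the value is gamma t. *)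
Lemma lie_exp_one_param Y : left_invariant Y ->
  one_param_subgroup Y (fun t => lie_exp (t *: Y)).
Proof.
move=> LY; have [gamma og] := one_param_subgroup_exists LY.
suff -> : (fun t => lie_exp (t *: Y)) = gamma by [].
apply/funext => t; have ot := one_param_subgroupZ t LY og.
have /one_param_subgroup_unique/(_ (xgetPex (fun=> 1%g) (ex_intro _ _ ot))) :=
  ot.
move=> /(_ (left_invariantZ t LY)) e; rewrite /lie_exp -e mulr1 //.
Qed.

End Exponential.

(** * Randers norms *)

Section BilinearForms.
Context {R : realType} {n : nat}.
Implicit Types (A : 'M[R]_n) (b u v w y : 'rV[R]_n) (a : R).

Definition bform A u v : R := (u *m A *m v^T) 0 0.
Definition lform b v : R := (b *m v^T) 0 0.

Lemma bformDl A u v w : bform A (u + v) w = bform A u w + bform A v w.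
Proof. by rewrite /bform !mulmxDl mxE. Qed.

Lemma bformDr A u v w : bform A u (v + w) = bform A u v + bform A u w.
Proof. by rewrite /bform linearD /= mulmxDr mxE. Qed.

Lemma bformZl A a u v : bform A (a *: u) v = a * bform A u v.
Proof. by rewrite /bform -!scalemxAl mxE. Qed.

Lemma bformZr A a u v : bform A u (a *: v) = a * bform A u v.
Proof. by rewrite /bform linearZ /= -scalemxAr mxE. Qed.

Lemma bformNl A u v : bform A (- u) v = - bform A u v.
Proof. by rewrite -scaleN1r bformZl mulN1r. Qed.

Lemma bformNr A u v : bform A u (- v) = - bform A u v.
Proof. by rewrite -scaleN1r bformZr mulN1r. Qed.

Lemma bform0l A v : bform A 0 v = 0.
Proof. by rewrite /bform !mul0mx mxE. Qed.

Lemma bform_sumr A u (I : finType) (v : I -> 'rV[R]_n) :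
  bform A u (\sum_i v i) = \sum_i bform A u (v i).
Proof. by rewrite /bform linear_sum /= mulmx_sumr summxE. Qed.

Lemma bform_suml A (I : finType) (u : I -> 'rV[R]_n) v :
  bform A (\sum_i u i) v = \sum_i bform A (u i) v.
Proof. by rewrite /bform !mulmx_suml summxE. Qed.

Lemma bformD A B u v : bform (A + B) u v = bform A u v + bform B u v.
Proof. by rewrite /bform mulmxDr mulmxDl mxE. Qed.

Lemma bformZ A a u v : bform (a *: A) u v = a * bform A u v.
Proof. by rewrite /bform -scalemxAr -scalemxAl mxE. Qed.

Lemma bformN A u v : bform (- A) u v = - bform A u v.
Proof. by rewrite -scaleN1r bformZ mulN1r. Qed.

Lemma bformC A u v : A^T = A -> bform A u v = bform A v u.
Proof.
move=> sA; have -> : bform A v u = (u *m A *m v^T)^T 0 0.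
  by rewrite !trmx_mul trmxK sA mulmxA.
by rewrite mxE.
Qed.

Lemma lformDl b c v : lform (b + c) v = lform b v + lform c v.
Proof. by rewrite /lform mulmxDl mxE. Qed.

Lemma lformDr b u v : lform b (u + v) = lform b u + lform b v.
Proof. by rewrite /lform linearD /= mulmxDr mxE. Qed.

Lemma lformZl a b v : lform (a *: b) v = a * lform b v.
Proof. by rewrite /lform -scalemxAl mxE. Qed.

Lemma lformZr a b v : lform b (a *: v) = a * lform b v.
Proof. by rewrite /lform linearZ /= -scalemxAr mxE. Qed.

Lemma lformNl b v : lform (- b) v = - lform b v.
Proof. by rewrite -scaleN1r lformZl mulN1r. Qed.

Lemma lformNr b v : lform b (- v) = - lform b v.
Proof. by rewrite -scaleN1r lformZr mulN1r. Qed.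

Lemma lform_mulmx A u v : lform (u *m A) v = bform A u v.
Proof. by []. Qed.

(** This converts the index sums in the spray coefficients into evaluations of linear forms. *)
Lemma sum_delta_linear (H : 'rV[R]_n -> R) :
  (forall a u v, H (a *: u + v) = a * H u + H v) ->
  forall y, \sum_m H (delta_mx 0 m) * y 0 m = H y.
Proof.
move=> linH y; have H0 : H 0 = 0.
  by have := linH 1 0 0; rewrite scaler0 addr0 mul1r => /eqP; rewrite -subr_eq subrr => /eqP.
have HD u v : H (u + v) = H u + H v by have := linH 1 u v; rewrite scale1r mul1r.
have HZ a u : H (a *: u) = a * H u by have := linH a u 0; rewrite H0 !addr0.
rewrite {2}(row_sum_delta y) (big_morph H HD H0).
by apply: eq_bigr => m _; rewrite HZ mulrC.
Qed.

Definition posdef A := A^T = A /\ forall v, v != 0 -> 0 < bform A v v.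

Lemma posdef_ge0 A v : posdef A -> 0 <= bform A v v.
Proof.
move=> [_ pA]; have [->|v0] := eqVneq v 0; first by rewrite bform0l.
exact/ltW/pA.
Qed.

Lemma posdef_eq0 A v : posdef A -> bform A v v = 0 -> v = 0.
Proof.
move=> [_ pA] Av; apply/eqP; apply: contraT => /pA.
by rewrite Av ltxx.
Qed.

(** The vector on the left is what remains of [u] after orthogonal projection on [v]. Its
    nonnegative square gives the Cauchy-Schwarz inequality, and its vanishing the equality case. *)
Lemma cauchy_schwarz_residual A u v : posdef A -> v != 0 ->
  bform A (u - (bform A v u / bform A v v) *: v)
          (u - (bform A v u / bform A v v) *: v) * bform A v v =
  bform A u u * bform A v v - bform A v u ^+ 2.
Proof.
move=> [sA pA] /pA vv; rewrite !(bformDl, bformDr, bformNl, bformNr, bformZl, bformZr).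
by rewrite (bformC u v sA); field; rewrite gt_eqF.
Qed.

Lemma cauchy_schwarz A u v : posdef A ->
  bform A v u ^+ 2 <= bform A u u * bform A v v.
Proof.
move=> pA; have [->|v0] := eqVneq v 0; first by rewrite !bform0l expr0n mulr0.
by rewrite -subr_ge0 -cauchy_schwarz_residual // mulr_ge0 // posdef_ge0.
Qed.

Lemma cauchy_schwarz_eq A u v : posdef A -> v != 0 ->
  bform A u u * bform A v v = bform A v u ^+ 2 -> exists a, u = a *: v.
Proof.
move=> pA v0 e; exists (bform A v u / bform A v v).
apply/eqP; rewrite -subr_eq0; apply/eqP; apply: (posdef_eq0 pA).
have := cauchy_schwarz_residual u pA v0; rewrite e subrr => /eqP.
by rewrite mulf_eq0 (gt_eqF (pA.2 _ v0)) orbF => /eqP.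
Qed.

End BilinearForms.

Section Derivatives.
Context {R : realType}.

(** Reduces a directional derivative to one real variable, where the derivative of the square root
    is available. *)
Lemma is_derive_lineP (V W : normedModType R) (f : V -> W) x v df :
  is_derive x v f df <-> is_derive (0 : R) 1 (fun h : R => f (h *: v + x)) df.
Proof.
have e : 'D_v f x = 'D_1 (fun h : R => f (h *: v + x)) (0 : R).
  rewrite /derive; set g1 := fun h => h^-1 *: _; set g2 := fun h => h^-1 *: _.
  suff -> : g1 = g2 by [].
  by apply/funext => h; rewrite /g1 /g2 /= addr0 scale0r add0r [_%:A]mulr1.
split=> -[d1 d2]; split.
- exact: (derivable1P f x v).1 d1.
- by rewrite -e.
- exact: (derivable1P f x v).2 d1.
- by rewrite e.
Qed.

Lemma is_derive_sqrt (V : normedModType R) (q : V -> R) x v dq :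
  0 < q x -> is_derive x v q dq ->
  is_derive x v (fun z => Num.sqrt (q z)) (dq / (2 * Num.sqrt (q x))).
Proof.
move=> qx /is_derive_lineP dq1; apply/is_derive_lineP.
have qx' : 0 < q (0 *: v + x) by rewrite scale0r add0r.
have ds := is_derive1_sqrt qx'.
have := @is_derive1_comp R Num.sqrt (fun h : R => q (h *: v + x)) 0 _ _ ds dq1.
by rewrite scale0r add0r mulrC.
Qed.

Lemma is_derive_inv (V : normedModType R) (f : V -> R) x v df :
  f x != 0 -> is_derive x v f df ->
  is_derive x v (fun z => (f z)^-1) (- df / f x ^+ 2).
Proof.
move=> fx [d1 d2]; split; first exact: derivableV.
by rewrite deriveV // d2 /GRing.scale /= mulNr mulrC mulNr.
Qed.

Lemma is_derive_mulmx (V : normedModType R) m p q (M : V -> 'M[R]_(m, p))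
    (N : V -> 'M[R]_(p, q)) x v dM dN :
  is_derive x v M dM -> is_derive x v N dN ->
  is_derive x v (fun z => M z *m N z) (dM *m N x + M x *m dN).
Proof.
move=> hM hN; apply: is_derive_mx => i j.
have -> : (fun z => (M z *m N z) i j) = \sum_k (fun z => M z i k * N z k j).
  by apply/funext => z; rewrite mxE fct_sumE.
rewrite !mxE -big_split /=; apply: is_derive_sum => k.
have hMk := is_derive_coord i k hM; have hNk := is_derive_coord k j hN.
have := is_deriveM hMk hNk; rewrite /GRing.scale /=.
by rewrite addrC [_ * dM _ _]mulrC.
Qed.

Lemma is_derive_trmx (V : normedModType R) m p (M : V -> 'M[R]_(m, p)) x v dM :
  is_derive x v M dM -> is_derive x v (fun z => (M z)^T) dM^T.
Proof.
move=> hM; apply: is_derive_mx => i j; rewrite mxE.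
have -> : (fun z => (M z)^T i j) = (fun z => M z j i) by apply/funext => z; rewrite mxE.
exact: is_derive_coord.
Qed.

Lemma is_derive_lform (V : normedModType R) n (b u : V -> 'rV[R]_n) x v db du :
  is_derive x v b db -> is_derive x v u du ->
  is_derive x v (fun z => lform (b z) (u z)) (lform db (u x) + lform (b x) du).
Proof.
move=> hb hu; have := is_derive_mulmx hb (is_derive_trmx hu).
by move=> /(is_derive_coord 0 0); rewrite mxE.
Qed.

Lemma is_derive_bform (V : normedModType R) n (A : V -> 'M[R]_n)
    (u w : V -> 'rV[R]_n) x v dA du dw :
  is_derive x v A dA -> is_derive x v u du -> is_derive x v w dw ->
  is_derive x v (fun z => bform (A z) (u z) (w z))
    (bform dA (u x) (w x) + bform (A x) du (w x) + bform (A x) (u x) dw).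
Proof.
move=> hA hu hw.
have := is_derive_lform (is_derive_mulmx hu hA) hw.
by rewrite lformDl !lform_mulmx [bform _ du _ + _]addrC.
Qed.

End Derivatives.

Section RandersNorm.
Context {R : realType} {n : nat}.
Context (A : 'M[R]_n) (b : 'rV[R]_n).
Context (dA : {linear 'rV[R]_n -> 'M[R]_n}) (db : {linear 'rV[R]_n -> 'rV[R]_n}).
Hypothesis pA : posdef A.
Implicit Types u v w y : 'rV[R]_n.

(* Derivatives of [F = randers_norm] at the vector [y]: the suffix [_y] stands
   for a derivative in the vector, along [u] or [w], the suffix [_x] for one in
   the base point, along [v]; [dA] and [db] are the differentials of the metric
   and of the 1-form in the base point. *)
Definition riem_norm y := Num.sqrt (bform A y y).
Definition randers_norm y := riem_norm y + lform b y.
Definition randers_y y w := bform A y w / riem_norm y + lform b w.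
Definition randers_x y v :=
  bform (dA v) y y / (2 * riem_norm y) + lform (db v) y.
Definition randers_yy y u w :=
  bform A u w / riem_norm y - bform A y u * bform A y w / riem_norm y ^+ 3.
Definition randers_xy y v w := bform (dA v) y w / riem_norm y -
  bform (dA v) y y * bform A y w / (2 * riem_norm y ^+ 3) + lform (db v) w.
Definition randers_tensor y u w :=
  randers_y y u * randers_y y w + randers_norm y * randers_yy y u w.

Lemma riem_norm_gt0 y : y != 0 -> 0 < riem_norm y.
Proof. by move=> /pA.2; rewrite sqrtr_gt0. Qed.

Lemma riem_norm_sqr y : bform A y y = riem_norm y ^+ 2.
Proof. by rewrite sqr_sqrtr // posdef_ge0. Qed.

Lemma riem_normN y : riem_norm (- y) = riem_norm y.
Proof. by rewrite /riem_norm bformNl bformNr opprK. Qed.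

(** Cauchy-Schwarz bounds beta(y)^2 by |X|^2 |y|^2 < |y|^2, so beta(y) cannot reach -|y|. *)
Lemma randers_norm_gt0 X y : b = X *m A -> bform A X X < 1 -> y != 0 ->
  0 < randers_norm y.
Proof.
move=> bE X1 y0; have a0 := riem_norm_gt0 y0.
have : lform b y ^+ 2 < riem_norm y ^+ 2.
  rewrite -riem_norm_sqr bE lform_mulmx -(bformC _ _ pA.1).
  rewrite (le_lt_trans (cauchy_schwarz X y pA)) // gtr_pMl //.
  exact: pA.2.
rewrite ltNge => lr; rewrite ltNge; apply: contra lr; rewrite /randers_norm.
by move: (lform b y) (riem_norm y) a0 => l r r0 lr; nra.
Qed.

(** This and the next two lemmas are Euler relations: in [y], F and its base point derivatives are
    homogeneous of degree 1, and the first vertical derivative of F of degree 0. *)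
Lemma randers_y_self y : y != 0 -> randers_y y y = randers_norm y.
Proof.
move=> /riem_norm_gt0 a0; rewrite /randers_y riem_norm_sqr /randers_norm.
by congr (_ + _); field; rewrite gt_eqF.
Qed.

Lemma randers_yy_self y w : y != 0 -> randers_yy y w y = 0.
Proof.
move=> /riem_norm_gt0 a0; rewrite /randers_yy riem_norm_sqr (bformC y w pA.1).
by field; rewrite gt_eqF.
Qed.

Lemma randers_xy_self y v : y != 0 -> randers_xy y v y = randers_x y v.
Proof.
move=> /riem_norm_gt0 a0; rewrite /randers_xy /randers_x riem_norm_sqr.
by field; rewrite gt_eqF.
Qed.

Lemma randers_yyC y u w : randers_yy y u w = randers_yy y w u.
Proof. by rewrite /randers_yy (bformC _ _ pA.1) [X in - (X / _)]mulrC. Qed.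

Lemma randers_yDr y u w : randers_y y (u + w) = randers_y y u + randers_y y w.
Proof. by rewrite /randers_y bformDr lformDr; ring. Qed.

Lemma randers_yZr y a w : randers_y y (a *: w) = a * randers_y y w.
Proof. by rewrite /randers_y bformZr lformZr; ring. Qed.

Lemma randers_yyDr y u v w : randers_yy y u (v + w) = randers_yy y u v + randers_yy y u w.
Proof. by rewrite /randers_yy !bformDr; ring. Qed.

Lemma randers_yyZr y a u w : randers_yy y u (a *: w) = a * randers_yy y u w.
Proof. by rewrite /randers_yy !bformZr; ring. Qed.

(** The tensor at (w, w) is F_y(w)^2 + F F_yy(w, w), a sum of nonnegative terms. If the second
    vanishes, equality in Cauchy-Schwarz makes [w] a multiple of [y]; the first then vanishes only
    for w = 0, because F_y(y) = F > 0. *)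
Lemma randers_tensor_nondegenerate y w : y != 0 -> 0 < randers_norm y ->
  randers_tensor y w w = 0 -> w = 0.
Proof.
move=> y0 F0; have a0 := riem_norm_gt0 y0; rewrite /randers_tensor => T0.
have yyE : randers_yy y w w =
    (bform A w w * bform A y y - bform A y w ^+ 2) / riem_norm y ^+ 3.
  by rewrite /randers_yy (riem_norm_sqr y); field; rewrite gt_eqF.
have yy0 : 0 <= randers_yy y w w.
  rewrite yyE; apply: divr_ge0; first by rewrite subr_ge0 cauchy_schwarz.
  by apply: exprn_ge0; exact: ltW.
have Fyy : 0 <= randers_norm y * randers_yy y w w by rewrite mulr_ge0 // ltW.
move: T0; rewrite -expr2 => /eqP; rewrite paddr_eq0 ?sqr_ge0 // sqrf_eq0 => /andP[].
move=> /eqP yw; rewrite mulf_eq0 (gt_eqF F0) /= yyE.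
rewrite mulf_eq0 invr_eq0 (gt_eqF (exprn_gt0 3 a0)) orbF.
rewrite subr_eq0 => /eqP /(cauchy_schwarz_eq pA y0)[a wE].
move: yw; rewrite wE randers_yZr randers_y_self // => /eqP.
by rewrite mulf_eq0 (gt_eqF F0) orbF => /eqP ->; rewrite scale0r.
Qed.

(* Contracting the Euler-Lagrange equations of [F^2] with [y] itself isolates the
   first conclusion; what remains after dividing by [F] is the second one. *)
Lemma spray_equations y g : y != 0 -> 0 < randers_norm y ->
  (forall w, 4 * randers_tensor y w g = 2 * (randers_y y w * randers_x y y +
    randers_norm y * (randers_xy y y w - randers_x y w))) ->
  2 * randers_y y g = randers_x y y /\
  forall w, 2 * randers_yy y w g = randers_xy y y w - randers_x y w.
Proof.
move=> y0 F0 E; have Fn0 : randers_norm y != 0 by rewrite gt_eqF.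
have e1 : 2 * randers_y y g = randers_x y y.
  have := E y; rewrite /randers_tensor randers_y_self // randers_xy_self //.
  rewrite (randers_yyC y y) randers_yy_self // subrr !mulr0 !addr0 => e.
  by apply: (mulfI Fn0); lra.
split=> // w; apply: (mulfI Fn0).
have := E w; rewrite /randers_tensor -e1; lra.
Qed.

(* Only the 1-form contributes an odd part to the second spray equation. *)
Lemma douglas_closed_form y w h a a' : y != 0 ->
  (forall w, 2 * randers_yy y w (h + a *: y) = randers_xy y y w - randers_x y w) ->
  (forall w, 2 * randers_yy (- y) w (h + a' *: - y) =
     randers_xy (- y) (- y) w - randers_x (- y) w) ->
  lform (db y) w = lform (db w) y.
Proof.
move=> y0 /(_ w) + /(_ w); have yn0 : - y != 0 by rewrite oppr_eq0.
(* The multiples of [y] are annihilated by [randers_yy]; the common vector [h] enters both equations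
   in the same way, since [randers_yy] is even in [y]. *)
rewrite !randers_yyDr !randers_yyZr !randers_yy_self // !mulr0 !addr0.
rewrite /randers_yy /randers_xy /randers_x riem_normN !linearN /=.
rewrite !(bformNl, bformNr, bformN, lformNl, lformNr) !opprK !(mulNr, mulrN, opprK).
lra.
Qed.

(* [s], [p] and [q] stand for D_Y Y, D_Y Z and D_Z Y, for left invariant Y and Z
   with values [y] and [w]; the hypotheses express that the inner products and the
   1-form are constant on left invariant fields. *)
Lemma geodesic_defect y w s p q g : y != 0 ->
  bform (dA y) y y + 2 * bform A s y = 0 ->
  bform (dA y) y w + bform A s w + bform A y p = 0 ->
  bform (dA w) y y + 2 * bform A q y = 0 ->
  lform (db y) y + lform b s = 0 ->
  lform (db y) w + lform b p = 0 ->
  lform (db w) y + lform b q = 0 ->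
  2 * randers_y y g = randers_x y y ->
  2 * randers_yy y w g = randers_xy y y w - randers_x y w ->
  randers_tensor y w (s + 2 *: g) = - randers_norm y * randers_y y (p - q).
Proof.
move=> y0 h1 h2 h3 h4 h5 h6 e1 e2; have a0 := riem_norm_gt0 y0.
(* F is constant on the values of a left invariant field, so F_y(s) = - F_x(y, y) by [h1] and [h4],
   and [e1] cancels this against 2 F_y(g). *)
have F0 : randers_y y (s + 2 *: g) = 0.
  rewrite randers_yDr randers_yZr e1 /randers_y /randers_x (bformC y s pA.1).
  have -> : bform (dA y) y y = - (2 * bform A s y) by apply/eqP; rewrite -addr_eq0 h1.
  have -> : lform (db y) y = - lform b s by apply/eqP; rewrite -addr_eq0 h4.
  by field; rewrite gt_eqF.
rewrite /randers_tensor F0 mulr0 add0r mulNr -mulrN; congr (_ * _).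
rewrite randers_yyDr randers_yyZr e2 /randers_yy /randers_xy /randers_x /randers_y.
have -> : bform (dA y) y y = - (2 * bform A s y) by apply/eqP; rewrite -addr_eq0 h1.
have -> : bform (dA w) y y = - (2 * bform A q y) by apply/eqP; rewrite -addr_eq0 h3.
have -> : bform (dA y) y w = - (bform A s w + bform A y p).
  by apply/eqP; rewrite -addr_eq0 addrA h2.
have -> : lform (db y) w = - lform b p by apply/eqP; rewrite -addr_eq0 h5.
have -> : lform (db w) y = - lform b q by apply/eqP; rewrite -addr_eq0 h6.
rewrite bformDr bformNr lformDr lformNr.
rewrite (bformC w s pA.1) (bformC y s pA.1) (bformC q y pA.1).
by field; rewrite gt_eqF.
Qed.

End RandersNorm.

Section RandersDerivatives.
Context {R : realType} {n : nat}.

Lemma is_derive_sqr (V : normedModType R) (f : V -> R) x v df :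
  is_derive x v f df -> is_derive x v (fun z => f z ^+ 2) (2 * f x * df).
Proof.
move=> hf; have -> : (fun z => f z ^+ 2) = f * f by apply/funext => z; rewrite expr2.
have := is_deriveM hf hf; rewrite /GRing.scale /=.
by have -> : f x * df + f x * df = 2 * f x * df by ring.
Qed.

Lemma is_derive_riem_norm (V : normedModType R) (A : V -> 'M[R]_n)
    (y : V -> 'rV[R]_n) x v dA dy : posdef (A x) -> y x != 0 ->
  is_derive x v A dA -> is_derive x v y dy ->
  is_derive x v (fun z => riem_norm (A z) (y z))
    (bform dA (y x) (y x) / (2 * riem_norm (A x) (y x)) +
     bform (A x) (y x) dy / riem_norm (A x) (y x)).
Proof.
move=> pA y0 hA hy; have := is_derive_sqrt (q := fun z => bform (A z) (y z) (y z)) (pA.2 _ y0)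
  (is_derive_bform hA hy hy).
have r0 := riem_norm_gt0 pA y0.
set d1 := (X in is_derive _ _ _ X); set d2 := (X in _ -> is_derive _ _ _ X).
suff -> : d1 = d2 by [].
rewrite /d1 /d2 (bformC dy _ pA.1) -/(riem_norm (A x) (y x)).
by field; rewrite gt_eqF.
Qed.

Lemma is_derive_randers_norm (V : normedModType R) (A : V -> 'M[R]_n)
    (b y : V -> 'rV[R]_n) x v dA db dy : posdef (A x) -> y x != 0 ->
  is_derive x v A dA -> is_derive x v b db -> is_derive x v y dy ->
  is_derive x v (fun z => randers_norm (A z) (b z) (y z))
    (bform dA (y x) (y x) / (2 * riem_norm (A x) (y x)) +
     bform (A x) (y x) dy / riem_norm (A x) (y x) +
     (lform db (y x) + lform (b x) dy)).
Proof.
move=> pA y0 hA hb hy.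
exact: is_deriveD (is_derive_riem_norm pA y0 hA hy) (is_derive_lform hb hy).
Qed.

Context (A : 'M[R]_n) (b : 'rV[R]_n).
Context (dA : {linear 'rV[R]_n -> 'M[R]_n}) (db : {linear 'rV[R]_n -> 'rV[R]_n}).
Hypothesis pA : posdef A.
Hypothesis dAC : forall v, (dA v)^T = dA v.

Lemma is_derive_riem_norm_y (y w : 'rV[R]_n) : y != 0 ->
  is_derive y w (riem_norm A) (bform A y w / riem_norm A y).
Proof.
move=> y0; have := is_derive_riem_norm (A := cst A) (y := id) pA y0
  (is_derive_cst A y w) (is_derive_id y w).
by rewrite /bform mulmx0 mul0mx mxE mul0r add0r.
Qed.

Lemma is_derive_randers_norm_y (y w : 'rV[R]_n) : y != 0 ->
  is_derive y w (randers_norm A b) (randers_y A b y w).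
Proof.
move=> y0; have := is_deriveD (is_derive_riem_norm_y w y0)
  (is_derive_lform (is_derive_cst b y w) (is_derive_id y w)).
by rewrite /lform mul0mx mxE add0r.
Qed.

Lemma is_derive_riem_norm_inv (y w : 'rV[R]_n) : y != 0 ->
  is_derive y w (fun z => (riem_norm A z)^-1) (- bform A y w / riem_norm A y ^+ 3).
Proof.
move=> y0; have r0 := riem_norm_gt0 pA y0; have rn0 : riem_norm A y != 0 by rewrite gt_eqF.
have := is_derive_inv rn0 (is_derive_riem_norm_y w y0).
have -> : - (bform A y w / riem_norm A y) / riem_norm A y ^+ 2 =
  - bform A y w / riem_norm A y ^+ 3 by field.
by [].
Qed.

Lemma is_derive_randers_y (y u w : 'rV[R]_n) : y != 0 ->
  is_derive y w (fun z => randers_y A b z u) (randers_yy A y u w).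
Proof.
move=> y0; have rn0 : riem_norm A y != 0 by rewrite gt_eqF // riem_norm_gt0.
have h1 := is_derive_bform (is_derive_cst A y w) (is_derive_id y w) (is_derive_cst u y w).
have h2 := is_deriveM h1 (is_derive_riem_norm_inv w y0).
have := is_deriveD h2 (is_derive_cst (lform b u) y w).
set d1 := (X in is_derive _ _ _ X); set d2 := (X in _ -> is_derive _ _ _ X).
suff -> : d1 = d2 by [].
rewrite /d1 /d2 /randers_yy /GRing.scale /= (bformC w u pA.1).
have -> : bform 0 y u = 0 by rewrite /bform mulmx0 mul0mx mxE.
have -> : bform A y 0 = 0 by rewrite /bform linear0 mulmx0 mxE.
by field.
Qed.

Lemma is_derive_randers_x (y v w : 'rV[R]_n) : y != 0 ->
  is_derive y w (fun z => randers_x A dA db z v) (randers_xy A dA db y v w).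
Proof.
move=> y0; have rn0 : riem_norm A y != 0 by rewrite gt_eqF // riem_norm_gt0.
have h1 := is_derive_bform (is_derive_cst (dA v) y w) (is_derive_id y w) (is_derive_id y w).
have h2 := is_deriveM h1 (is_deriveZ (2^-1) (is_derive_riem_norm_inv w y0)).
have := is_deriveD h2 (is_derive_lform (is_derive_cst (db v) y w) (is_derive_id y w)).
have -> : (fun z => randers_x A dA db z v) =
    (fun z => bform (dA v) z z) * (2^-1 \*: (fun z => (riem_norm A z)^-1)) +
    (fun z => lform (db v) z).
  by apply/funext => z; rewrite /randers_x invfM.
set d1 := (X in is_derive _ _ _ X); set d2 := (X in _ -> is_derive _ _ _ X).
suff -> : d1 = d2 by [].
rewrite /d1 /d2 /randers_xy /GRing.scale /= (bformC w y (dAC v)).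
have -> : bform 0 y y = 0 by rewrite /bform mulmx0 mul0mx mxE.
have -> : lform 0 y = 0 by rewrite /lform mul0mx mxE.
have -> : 2^-1 *: (riem_norm A y)^-1 = 2^-1 * (riem_norm A y)^-1 :> R by [].
by field.
Qed.

End RandersDerivatives.

Section RandersTensorMatrix.
Context {R : realType} {n : nat} (A : 'M[R]_n) (b : 'rV[R]_n).
Hypothesis pA : posdef A.
Implicit Types y u w : 'rV[R]_n.

Definition randers_mx y : 'M[R]_n :=
  \matrix_(i, j) randers_tensor A b y (delta_mx 0 i) (delta_mx 0 j).

Lemma randers_tensorC y u w : randers_tensor A b y u w = randers_tensor A b y w u.
Proof.
by rewrite /randers_tensor (randers_yyC pA) [randers_y _ _ _ _ * _]mulrC.
Qed.

Lemma randers_tensor_linear y u a w1 w2 :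
  randers_tensor A b y u (a *: w1 + w2) =
  a * randers_tensor A b y u w1 + randers_tensor A b y u w2.
Proof.
rewrite /randers_tensor randers_yDr randers_yZr randers_yyDr randers_yyZr.
by ring.
Qed.

Lemma bform_randers_mx y u w : bform (randers_mx y) u w = randers_tensor A b y u w.
Proof.
rewrite /bform mxE -(sum_delta_linear (randers_tensor_linear y u)).
apply: eq_bigr => j _; rewrite [w^T _ _]mxE; congr (_ * _).
rewrite [RHS]randers_tensorC -(sum_delta_linear (randers_tensor_linear y _)) mxE.
by apply: eq_bigr => i _; rewrite mxE randers_tensorC mulrC.
Qed.

Lemma randers_mx_unit y : y != 0 -> 0 < randers_norm A b y ->
  randers_mx y \in unitmx.
Proof.
move=> y0 F0; rewrite unitmxE unitfE; apply/det0P => -[v v0 vT].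
suff /(randers_tensor_nondegenerate pA y0 F0) : randers_tensor A b y v v = 0.
  by move/eqP; rewrite (negPf v0).
by rewrite -bform_randers_mx /bform vT mul0mx mxE.
Qed.

End RandersTensorMatrix.

Lemma near_neq0 (R : realType) (V : normedModType R) (y : V) :
  y != 0 -> \forall z \near y, z != 0.
Proof. by move=> y0; apply: cvgr_neq0 y0; exact: cvg_id. Qed.

(** * The spray of a Randers metric in a chart *)

Section RandersSpray.
Context {R : realType} {n : nat} {M : manifoldType R n}.
Context (F : finsler M) (phi : chart R n M) (U : set 'rV[R]_n).
Context (A : 'rV[R]_n -> 'M[R]_n) (b : 'rV[R]_n -> 'rV[R]_n).
Hypotheses (oU : open U) (pA : forall u, U u -> posdef (A u)).
Hypothesis FE : forall u y, sqF F phi u y = randers_norm (A u) (b u) y ^+ 2.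
Context (x : 'rV[R]_n).
Hypotheses (Ux : U x) (dA : differentiable A x) (db : differentiable b x).

Let dA' : {linear 'rV[R]_n -> 'M[R]_n} := 'd A x.
Let db' : {linear 'rV[R]_n -> 'rV[R]_n} := 'd b x.
Local Notation N := (randers_norm (A x) (b x)).

Lemma diff_metric_sym v : (dA' v)^T = dA' v.
Proof.
rewrite -[dA' v]deriveE //.
have dv := derivableP (diff_derivable (v := v) dA).
have [_ <-] := is_derive_trmx dv; apply: near_eq_derive; near=> u.
by apply: (pA _).1; near: u; exact: open_nbhs_nbhs.
Unshelve. all: by end_near. Qed.

Lemma sqF_xE m y : y != 0 -> sqF_x F phi m x y =
  2 * N y * randers_x (A x) dA' db' y (delta_mx 0 m).
Proof.
move=> y0; rewrite /sqF_x /ebasis.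
have -> : (fun u => sqF F phi u y : R^o) = (fun u => randers_norm (A u) (b u) y ^+ 2).
  by apply/funext => u; rewrite FE.
have hA := derivableP (diff_derivable (v := delta_mx 0 m) dA).
have hb := derivableP (diff_derivable (v := delta_mx 0 m) db).
have := is_derive_sqr (is_derive_randers_norm (y := cst y) (pA Ux) y0 hA hb
  (is_derive_cst y x (delta_mx 0 m))).
move=> [_ ->]; rewrite /randers_x /dA' /db' -!deriveE //; congr (_ * _).
have -> : bform (A x) y 0 = 0 by rewrite /bform linear0 mulmx0 mxE.
have -> : lform (b x) 0 = 0 by rewrite /lform linear0 mulmx0 mxE.
by rewrite mul0r !addr0.
Qed.

Lemma sqF_yE m y : y != 0 -> sqF_y F phi m x y =
  2 * N y * randers_y (A x) (b x) y (delta_mx 0 m).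
Proof.
move=> y0; rewrite /sqF_y /ebasis.
have -> : (fun y' => sqF F phi x y' : R^o) = (fun y' => N y' ^+ 2).
  by apply/funext => u; rewrite FE.
by have [_ ->] := is_derive_sqr (is_derive_randers_norm_y (b x) (pA Ux) (delta_mx 0 m) y0).
Qed.

(** The formula for [sqF_x] holds only at nonzero vectors, but these form a neighbourhood of [y],
    which suffices to differentiate it again. *)
Lemma sqF_xyE m l y : y != 0 -> sqF_xy F phi m l x y =
  2 * (randers_y (A x) (b x) y (delta_mx 0 l) * randers_x (A x) dA' db' y (delta_mx 0 m) +
       N y * randers_xy (A x) dA' db' y (delta_mx 0 m) (delta_mx 0 l)).
Proof.
move=> y0; rewrite /sqF_xy /ebasis.
have h1 := is_derive_randers_norm_y (b x) (pA Ux) (delta_mx 0 l) y0.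
have h2 := is_derive_randers_x db' (pA Ux) diff_metric_sym (delta_mx 0 m) (delta_mx 0 l) y0.
have h3 := is_deriveZ 2 (is_deriveM h1 h2).
have [_ e] : is_derive y (delta_mx 0 l) (fun y' => sqF_x F phi m x y' : R^o)
    (2 *: (N y *: randers_xy (A x) dA' db' y (delta_mx 0 m) (delta_mx 0 l) +
     randers_x (A x) dA' db' y (delta_mx 0 m) *: randers_y (A x) (b x) y (delta_mx 0 l))).
  apply: near_eq_is_derive h3; near=> z; rewrite sqF_xE; last first.
    by near: z; exact: near_neq0 y0.
  by rewrite /= -mulrA.
by rewrite e /GRing.scale /=; ring.
Unshelve. all: by end_near. Qed.

Lemma sqF_yyE i j y : y != 0 -> sqF_yy F phi i j x y =
  2 * randers_tensor (A x) (b x) y (delta_mx 0 i) (delta_mx 0 j).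
Proof.
move=> y0; rewrite /sqF_yy /ebasis.
have h1 := is_derive_randers_norm_y (b x) (pA Ux) (delta_mx 0 j) y0.
have h2 := is_derive_randers_y (b x) (pA Ux) (delta_mx 0 i) (delta_mx 0 j) y0.
have h3 := is_deriveZ 2 (is_deriveM h1 h2).
have [_ e] : is_derive y (delta_mx 0 j) (fun y' => sqF_y F phi i x y' : R^o)
    (2 *: (N y *: randers_yy (A x) y (delta_mx 0 i) (delta_mx 0 j) +
     randers_y (A x) (b x) y (delta_mx 0 i) *: randers_y (A x) (b x) y (delta_mx 0 j))).
  apply: near_eq_is_derive h3; near=> z; rewrite sqF_yE; last first.
    by near: z; exact: near_neq0 y0.
  by rewrite /= -mulrA.
by rewrite e /GRing.scale /= /randers_tensor; ring.
Unshelve. all: by end_near. Qed.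

Lemma fundamental_tensorE y : y != 0 ->
  fundamental_tensor F phi x y = randers_mx (A x) (b x) y.
Proof.
move=> y0; apply/matrixP => i j; rewrite !mxE sqF_yyE //.
by rewrite mulrA mulVf ?mul1r.
Qed.

(** Contracting with the fundamental tensor cancels its inverse in the definition of the spray and
    leaves the Euler-Lagrange expression of F^2, in which no index remains. *)
Lemma spray_lowered y : y != 0 -> 0 < N y -> forall w,
  4 * randers_tensor (A x) (b x) y w (\row_i spray F phi x y i) =
  2 * (randers_y (A x) (b x) y w * randers_x (A x) dA' db' y y +
    N y * (randers_xy (A x) dA' db' y y w - randers_x (A x) dA' db' y w)).
Proof.
move=> y0 N0 w; pose T := randers_mx (A x) (b x) y.
pose c : 'cV[R]_n := \col_l (\sum_m sqF_xy F phi m l x y * y 0 m - sqF_x F phi l x y).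
have gE : (\row_i spray F phi x y i)^T = 4^-1 *: (invmx T *m c).
  apply/colP => i; rewrite !mxE /spray fundamental_tensorE //; congr (_ * _).
  by apply: eq_bigr => l _; rewrite mxE.
have TgE : T *m (\row_i spray F phi x y i)^T = 4^-1 *: c.
  by rewrite gE -scalemxAr mulmxA mulmxV ?mul1mx //; exact: (randers_mx_unit (pA Ux)).
have -> : randers_tensor (A x) (b x) y w (\row_i spray F phi x y i) =
    (w *m (T *m (\row_i spray F phi x y i)^T)) 0 0.
  by rewrite mulmxA -[RHS]/(bform T w _) (bform_randers_mx _ (pA Ux)).
rewrite TgE.
have -> : (w *m (4^-1 *: c)) 0 0 = 4^-1 * (w *m c) 0 0.
  by rewrite -scalemxAr mxE.
rewrite mulrA mulfV // mul1r mxE.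
have dAl a u v : dA' (a *: u + v) = a *: dA' u + dA' v by exact: linearP.
have dbl a u v : db' (a *: u + v) = a *: db' u + db' v by exact: linearP.
(* [H] is the right-hand side as a linear form in the test vector, so it is enough to compare on
   basis vectors; [K] below plays the same part for the sum over [m]. *)
pose H u := 2 * (randers_y (A x) (b x) y u * randers_x (A x) dA' db' y y +
    N y * (randers_xy (A x) dA' db' y y u - randers_x (A x) dA' db' y u)).
have linH a u v : H (a *: u + v) = a * H u + H v.
  rewrite /H randers_yDr randers_yZr /randers_xy /randers_x dAl dbl.
  rewrite !(bformDr, bformZr, bformD, bformZ, lformDl, lformDr, lformZl, lformZr).
  by ring.
rewrite -[RHS](sum_delta_linear linH); apply: eq_bigr => l _.
rewrite mxE mulrC; congr (_ * _); rewrite sqF_xE // /H.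
pose K v := 2 * (randers_y (A x) (b x) y (delta_mx 0 l) * randers_x (A x) dA' db' y v +
    N y * randers_xy (A x) dA' db' y v (delta_mx 0 l)).
have linK a u v : K (a *: u + v) = a * K u + K v.
  rewrite /K /randers_xy /randers_x dAl dbl.
  rewrite !(bformD, bformZ, lformDl, lformZl).
  by ring.
have -> : \sum_m sqF_xy F phi m l x y * y 0 m = K y.
  rewrite -(sum_delta_linear linK); apply: eq_bigr => m _.
  by rewrite sqF_xyE.
by rewrite /K; ring.
Qed.

End RandersSpray.

Lemma innerE (R : realType) n (M : manifoldType R n) (g : metric M) p phi v w :
  inner g p phi v w = bform (g p phi) v w.
Proof. by []. Qed.

Lemma differentiable_mulmx (R : realType) (V : normedModType R) n
    (u : V -> 'rV[R]_n) (A : V -> 'M[R]_n) x :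
  differentiable u x -> differentiable A x ->
  differentiable (fun z => u z *m A z) x.
Proof.
move=> du dA.
have dcoord m p (B : V -> 'M[R]_(m, p)) i j : differentiable B x ->
    differentiable (fun z => B z i j : R) x.
  move=> dB; apply: (@differentiable_comp _ _ _ _ B (fun N => N i j)) => //.
  exact: differentiable_coord.
have -> : (fun z => u z *m A z) = \sum_(j < n) \sum_(i < n)
    (fun z => (u z 0 i * A z i j) *: (delta_mx 0 j : 'rV[R]_n)).
  apply/funext => z; rewrite [LHS]row_sum_delta fct_sumE; apply: eq_bigr => j _.
  by rewrite mxE fct_sumE scaler_suml.
apply: differentiable_sum => j; apply: differentiable_sum => i.
apply: differentiableZl; apply: differentiableM; exact: dcoord.
Qed.

(** * Left invariant Randers metrics *)

Section VectorFields.
Context {R : realType} {n : nat} {M : manifoldType R n}.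
Implicit Types (Y Z W : vfield M) (p : M) (phi : chart R n M).

Definition local_rep Y phi : 'rV[R]_n -> 'rV[R]_n := fun u => Y (cinv phi u) phi.

Lemma local_repE Y phi p : chart_at p phi -> local_rep Y phi (phi p) = Y p phi.
Proof. by move=> cp; rewrite /local_rep cmapK. Qed.

Lemma vfield_sumE (I : finType) (y : I -> R) (E : I -> vfield M) p phi :
  (\sum_i y i *: E i) p phi = \sum_i y i *: E i p phi.
Proof. by rewrite !fct_sumE. Qed.

Lemma vfield_differentiable Y phi u : is_vfield Y -> atlas phi -> cimg phi u ->
  differentiable (local_rep Y phi) u.
Proof. by move=> [_ _ sY] aphi Uu; apply: smooth_differentiable (sY phi aphi) Uu. Qed.

Lemma lie_bracketE Y Z p phi : chart_at p phi -> lie_bracket Y Z p phi =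
  'D_(Y p phi) (local_rep Z phi) (phi p) - 'D_(Z p phi) (local_rep Y phi) (phi p).
Proof. by move=> cp; rewrite /lie_bracket asboolT. Qed.

Lemma lie_bracketC Y Z p phi : chart_at p phi ->
  lie_bracket Y Z p phi = - lie_bracket Z Y p phi.
Proof. by move=> cp; rewrite !lie_bracketE // opprB. Qed.

Lemma lie_bracket_suml (I : finType) (y : I -> R) (E : I -> vfield M) Z p phi :
  (forall i, is_vfield (E i)) -> is_vfield Z -> chart_at p phi ->
  lie_bracket (\sum_i y i *: E i) Z p phi = \sum_i y i *: lie_bracket (E i) Z p phi.
Proof.
move=> vE vZ cp; have [aphi Up] := (cp.1, chart_cimg cp).
have dZ := vfield_differentiable vZ aphi Up.
have dE i := vfield_differentiable (vE i) aphi Up.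
have -> : \sum_i y i *: lie_bracket (E i) Z p phi =
    \sum_i y i *: 'D_(E i p phi) (local_rep Z phi) (phi p) -
    \sum_i y i *: 'D_(Z p phi) (local_rep (E i) phi) (phi p).
  by rewrite -sumrB; apply: eq_bigr => i _; rewrite lie_bracketE // scalerBr.
rewrite lie_bracketE //; congr (_ - _).
  rewrite deriveE // vfield_sumE linear_sum /=; apply: eq_bigr => i _.
  by rewrite linearZ /= deriveE.
have -> : local_rep (\sum_i y i *: E i) phi = \sum_i y i *: local_rep (E i) phi.
  by apply/funext => u; rewrite /local_rep vfield_sumE fct_sumE.
have : is_derive (phi p) (Z p phi) (\sum_i y i *: local_rep (E i) phi)
    (\sum_i y i *: 'D_(Z p phi) (local_rep (E i) phi) (phi p)).
  elim/big_ind2 : _ => [|f df g dg hf hg|i _].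
  - exact: (is_derive_cst 0).
  - exact: is_deriveD.
  - by apply: is_deriveZ; apply: derivableP; exact: diff_derivable.
by case.
Qed.

End VectorFields.

Section InvariantRanders.
Context {R : realType} {n : nat} {G : lieGroupType R n}.
Context (ta : metric G) (E : n.-tuple (vfield G)) (X : vfield G).
Hypothesis ta_riemannian : riemannian_metric ta.
Hypothesis E_basis : lie_algebra_basis E.
Hypothesis E_orthonormal : orthonormal_frame ta E.
Hypothesis X_invariant : left_invariant X.
Hypothesis X_lt1 : forall p phi, chart_at p phi ->
  Num.sqrt (inner ta p phi (X p phi) (X p phi)) < 1.
Implicit Types (Y Z W : vfield G) (p : G) (phi : chart R n G).

Lemma metric_posdef p phi : chart_at p phi -> posdef (ta p phi).
Proof.
have [sym pos _ _] := ta_riemannian.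
by move=> cp; split; [exact: sym | move=> v v0; exact: pos].
Qed.

Lemma left_invariant_coord Y : left_invariant Y ->
  exists y : 'I_n -> R, Y = \sum_i y i *: tnth E i.
Proof. by move=> /(E_basis.2)[y [-> _]]; exists y. Qed.

Lemma inner_frame (y : 'I_n -> R) j p phi : chart_at p phi ->
  inner ta p phi ((\sum_i y i *: tnth E i) p phi) (tnth E j p phi) = y j.
Proof.
move=> cp; rewrite vfield_sumE innerE bform_suml (bigD1 j) //= big1 ?addr0 => [|i ij].
  by rewrite bformZl -innerE E_orthonormal // eqxx mulr1.
by rewrite bformZl -innerE E_orthonormal // (negPf ij) mulr0.
Qed.

Lemma inner_coord (y z : 'I_n -> R) p phi : chart_at p phi ->
  inner ta p phi ((\sum_i y i *: tnth E i) p phi) ((\sum_i z i *: tnth E i) p phi) =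
  \sum_i y i * z i.
Proof.
move=> cp; rewrite (vfield_sumE z) innerE bform_sumr; apply: eq_bigr => i _.
by rewrite bformZr -innerE inner_frame // mulrC.
Qed.

Lemma inner_left_invariant Y Z : left_invariant Y -> left_invariant Z ->
  exists k : R, forall p phi, chart_at p phi -> inner ta p phi (Y p phi) (Z p phi) = k.
Proof.
move=> /left_invariant_coord[y ->] /left_invariant_coord[z ->].
by exists (\sum_i y i * z i) => p phi cp; exact: inner_coord.
Qed.

(** The squared length of [Y] is the sum of the squares of its constant frame coordinates, so
    vanishing at one point kills them all. *)
Lemma left_invariant_neq0 Y p phi : left_invariant Y -> Y <> 0 -> chart_at p phi ->
  Y p phi != 0.
Proof.
move=> LY Y0 cp; apply/eqP => Yp; apply: Y0.
have [y YE] := left_invariant_coord LY; rewrite YE; rewrite YE in Yp.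
have := inner_coord y y cp; rewrite Yp innerE bform0l => /esym/eqP.
rewrite psumr_eq0 => [|i _]; last by rewrite -expr2 sqr_ge0.
move=> /allP y0; rewrite big1 // => i _.
have := y0 i; rewrite mem_index_enum => /(_ isT); rewrite mulf_eq0 orbb => /eqP ->.
by rewrite scale0r.
Qed.

Section AtPoint.
Context (p : G) (phi : chart R n G).
Hypothesis cp : chart_at p phi.

Let A u := ta (cinv phi u) phi.
(** Coordinates of the 1-form beta = a~(X, .), that is, [X] with its index lowered. *)
Let b u := local_rep X phi u *m A u.
Let x := phi p.
Let aphi : atlas phi := cp.1.
Let Ux : cimg phi x := chart_cimg cp.

Let AE : A x = ta p phi.
Proof. by rewrite /A cmapK. Qed.

Let pA u : cimg phi u -> posdef (A u).
Proof. by move=> Uu; apply: metric_posdef; exact: cinv_chart_at. Qed.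

Let dA : differentiable A x.
Proof.
have [_ _ _ sm] := ta_riemannian.
by apply: smooth_differentiable (sm phi aphi) Ux.
Qed.

Let db : differentiable b x.
Proof.
apply: differentiable_mulmx dA; apply: vfield_differentiable => //.
by case: X_invariant.
Qed.

Let dA' : {linear 'rV[R]_n -> 'M[R]_n} := 'd A x.
Let db' : {linear 'rV[R]_n -> 'rV[R]_n} := 'd b x.

Let FE u y : sqF (randers ta X) phi u y = randers_norm (A u) (b u) y ^+ 2.
Proof. by []. Qed.

Let N_gt0 y : y != 0 -> 0 < randers_norm (A x) (b x) y.
Proof.
apply: (@randers_norm_gt0 _ _ _ _ _ (local_rep X phi x)) => //; first exact: pA.
rewrite AE local_repE // -innerE.
by have := X_lt1 cp; rewrite -{1}sqrtr1 ltr_sqrt.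
Qed.

Let spray_eqs y : y != 0 ->
  let g := \row_i spray (randers ta X) phi x y i in
  2 * randers_y (A x) (b x) y g = randers_x (A x) dA' db' y y /\
  forall w, 2 * randers_yy (A x) y w g =
    randers_xy (A x) dA' db' y y w - randers_x (A x) dA' db' y w.
Proof.
move=> y0 g; apply: spray_equations => //; [exact: pA | exact: N_gt0 |].
apply: (@spray_lowered _ _ _ _ _ (cimg phi) A b) => //; [exact: cimg_open | exact: N_gt0].
Qed.

(** The quadratic part [h] of the Douglas form takes the same value at [v] and at [-v], so the spray
    equations at these two vectors can be compared. The case v = 0 is separate, as the spray is
    usable on nonzero vectors only. *)
Lemma randers_closed : douglas (randers ta X) ->
  forall v w, lform (db' v) w = lform (db' w) v.
Proof.
move=> /(_ phi aphi)[Gamma [P [_ sprayE]]] v w.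
have [->|v0] := eqVneq v 0.
  by rewrite linear0 /lform mul0mx linear0 mulmx0 !mxE.
pose h (y : 'rV[R]_n) : 'rV[R]_n := \row_i (2^-1 * \sum_j \sum_k Gamma i j k x * y 0 j * y 0 k).
have gE y : y != 0 -> \row_i spray (randers ta X) phi x y i = h y + P x y *: y.
  by move=> y0; apply/rowP => i; rewrite !mxE sprayE.
have hN : h (- v) = h v.
  apply/rowP => i; rewrite !mxE; congr (_ * _); apply: eq_bigr => j _.
  by apply: eq_bigr => k _; rewrite !mxE; ring.
have vn0 : - v != 0 by rewrite oppr_eq0.
have [_ e1] := spray_eqs v0; have [_ e2] := spray_eqs vn0.
rewrite gE // in e1; rewrite gE // hN in e2.
apply: (douglas_closed_form (pA Ux) _ v0 e1 e2).
Qed.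

Let derive_inner Y Z v : left_invariant Y -> left_invariant Z ->
  bform (dA' v) (Y p phi) (Z p phi) +
  bform (A x) ('D_v (local_rep Y phi) x) (Z p phi) +
  bform (A x) (Y p phi) ('D_v (local_rep Z phi) x) = 0.
Proof.
move=> LY LZ; have [k Hk] := inner_left_invariant LY LZ.
have dv (W : normedModType R) (f : 'rV[R]_n -> W) : differentiable f x ->
    is_derive x v f ('D_v f x) by move=> df; apply: derivableP; exact: diff_derivable.
have dY := dv _ _ (vfield_differentiable LY.1 aphi Ux).
have dZ := dv _ _ (vfield_differentiable LZ.1 aphi Ux).
have := is_derive_bform (dv _ _ dA) dY dZ.
rewrite !local_repE // [in X in is_derive _ _ _ X](deriveE _ dA) => -[_ <-].
rewrite -(derive_cst k x v); apply: near_eq_derive; near=> u.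
rewrite /A /local_rep -innerE Hk //; apply: cinv_chart_at => //.
by near: u; apply: open_nbhs_nbhs; split => //; exact: cimg_open.
Unshelve. all: by end_near. Qed.

Let derive_form Z v : left_invariant Z ->
  lform (db' v) (Z p phi) + lform (b x) ('D_v (local_rep Z phi) x) = 0.
Proof.
move=> LZ; have [k Hk] := inner_left_invariant X_invariant LZ.
have dv (W : normedModType R) (f : 'rV[R]_n -> W) : differentiable f x ->
    is_derive x v f ('D_v f x) by move=> df; apply: derivableP; exact: diff_derivable.
have dZ := dv _ _ (vfield_differentiable LZ.1 aphi Ux).
have := is_derive_lform (dv _ _ db) dZ.
rewrite !local_repE // [in X in is_derive _ _ _ X](deriveE _ db) => -[_ <-].
rewrite -(derive_cst k x v); apply: near_eq_derive; near=> u.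
rewrite /b lform_mulmx /A /local_rep -innerE Hk //; apply: cinv_chart_at => //.
by near: u; apply: open_nbhs_nbhs; split => //; exact: cimg_open.
Unshelve. all: by end_near. Qed.

(* For a closed left invariant 1-form, d(beta)(Y, Z) = - beta [Y, Z]. *)
Lemma form_lie_bracket Y Z : douglas (randers ta X) ->
  left_invariant Y -> left_invariant Z ->
  inner ta p phi (X p phi) (lie_bracket Y Z p phi) = 0.
Proof.
move=> dg LY LZ; rewrite innerE -lform_mulmx -AE -(local_repE X cp) -/(b x).
rewrite lie_bracketE // lformDr lformNr.
have := derive_form (Y p phi) LZ; have := derive_form (Z p phi) LY.
rewrite (randers_closed dg (Z p phi) (Y p phi)).
move: (lform (db' _) _) (lform (b x) _) (lform (b x) _) => c1 c2 c3; lra.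
Qed.

(** Orthonormality reads B A B^T = 1 for the matrix [B] of frame values, which makes [B]
    invertible. *)
Lemma frame_span (v : 'rV[R]_n) : exists c : 'I_n -> R, v = \sum_i c i *: tnth E i p phi.
Proof.
pose B : 'M[R]_n := \matrix_i tnth E i p phi.
have BAB : B *m ta p phi *m B^T = 1%:M.
  apply/matrixP => i j; rewrite [RHS]mxE -(E_orthonormal i j cp) /inner !mxE.
  apply: eq_bigr => k _; rewrite !mxE; congr (_ * _).
  by apply: eq_bigr => l _; rewrite mxE.
have Bu : B \in unitmx.
  by have := mulmx1_unit BAB => -[_]; rewrite unitmx_tr.
exists (fun i => (v *m invmx B) 0 i).
rewrite -{1}(mulmxKV Bu v) mulmx_sum_row; apply: eq_bigr => i _.
by congr (_ *: _); apply/rowP => j; rewrite !mxE.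
Qed.

(** Paired with E_j by the fundamental tensor, the left-hand side gives - F a~(Y, [Y, E_j]) / |Y|, a
    nonzero multiple of the right-hand side. Conversely, if all these pairings vanish, the left-hand
    side is expanded in the frame, so its pairing with itself is 0 and nondegeneracy applies. *)
Lemma geodesic_equation Y : douglas (randers ta X) -> left_invariant Y -> Y <> 0 ->
  'D_(Y p phi) (local_rep Y phi) x +
    2 *: \row_i spray (randers ta X) phi x (Y p phi) i = 0 <->
  forall j, inner ta p phi (Y p phi) (lie_bracket Y (tnth E j) p phi) = 0.
Proof.
move=> dg LY Y0; have y0 := left_invariant_neq0 LY Y0 cp.
set y := Y p phi; set g := \row_i _; set s := 'D_y _ _.
have N0 := N_gt0 y0; have r0 := riem_norm_gt0 (pA Ux) y0.
have LE j : left_invariant (tnth E j) by case: E_basis => + _; apply.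
have [e1 e2] := spray_eqs y0.
have tensorE j : randers_tensor (A x) (b x) y (tnth E j p phi) (s + 2 *: g) =
    - randers_norm (A x) (b x) y *
    (inner ta p phi y (lie_bracket Y (tnth E j) p phi) / riem_norm (A x) y).
  (* Here the Douglas condition enters: beta([Y, E_j]) = 0 leaves only the Riemannian term of
     [geodesic_defect]. *)
  have := form_lie_bracket dg LY (LE j).
  rewrite innerE -lform_mulmx -AE -(local_repE X cp).
  rewrite -/(b x) lie_bracketE // => b0.
  rewrite (geodesic_defect (pA Ux) (p := 'D_y (local_rep (tnth E j) phi) x)
    (q := 'D_(tnth E j p phi) (local_rep Y phi) x) y0 _ _ _ _ _ _ e1 (e2 _)).
  - by rewrite /randers_y b0 addr0 innerE -AE.
  - have := derive_inner y LY LY.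
    rewrite (bformC y _ (pA Ux).1) -/y -/s => <-; ring.
  - exact: (derive_inner y LY (LE j)).
  - have := derive_inner (tnth E j p phi) LY LY.
    rewrite (bformC y _ (pA Ux).1) -/y => <-; ring.
  - exact: (derive_form y LY).
  - exact: (derive_form y (LE j)).
  - exact: (derive_form (tnth E j p phi) LY).
split=> [V0 j|inner0].
  have := tensorE j; rewrite V0.
  have -> w : randers_tensor (A x) (b x) y w 0 = 0.
    have := bformZr (randers_mx (A x) (b x) y) 0 w 0.
    by rewrite scale0r mul0r (bform_randers_mx _ (pA Ux)).
  move=> /esym/eqP; rewrite mulf_eq0 oppr_eq0 (gt_eqF N0) /= mulf_eq0 invr_eq0.
  by rewrite (gt_eqF r0) orbF => /eqP.
apply: (randers_tensor_nondegenerate (pA Ux) y0 N0).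
set V := s + 2 *: g in tensorE *.
have [c VE] := frame_span V.
rewrite {2}VE -(bform_randers_mx _ (pA Ux)) bform_sumr big1 // => i _.
rewrite bformZr (bform_randers_mx _ (pA Ux)) (randers_tensorC _ (pA Ux)).
by rewrite tensorE inner0 mul0r !mulr0.
Qed.

End AtPoint.

(** The identity x' = Y(x) holds on a neighbourhood of [t], since the chart domain is open, and can
    be differentiated once more. *)
Lemma exp_derivatives Y (t : R) phi : left_invariant Y ->
  let gamma s := lie_exp (s *: Y) in
  chart_at (gamma t) phi ->
  (fun s => phi (gamma s))^`()%classic t = Y (gamma t) phi /\
  (fun s => phi (gamma s))^`(2)%classic t =
    'D_(Y (gamma t) phi) (local_rep Y phi) (phi (gamma t)).
Proof.
move=> LY gamma ct; have og : one_param_subgroup Y gamma := lie_exp_one_param LY.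
have d1 := one_param_subgroup_is_derive LY og.
have d1E s : chart_at (gamma s) phi ->
    (fun s => phi (gamma s))^`()%classic s = Y (gamma s) phi.
  by move=> cs; rewrite derive1E; have [_ ->] := d1 s phi cs.
split; first exact: d1E.
rewrite derive1nS derive1n1 derive1E.
have [_ <-] := is_derive_comp_curve (d1 t phi ct)
  (vfield_differentiable LY.1 ct.1 (chart_cimg ct)).
apply: near_eq_derive; near=> s.
have cs : chart_at (gamma s) phi.
  split; first exact: ct.1.
  near: s; have [[cg _] _ _] := og.
  by have := cg t; apply; exact: nbhs_cdom.
by rewrite d1E // local_repE.
Unshelve. all: by end_near. Qed.

Lemma geodesic_vector_orthogonal Y : douglas (randers ta X) -> Y <> 0 ->
  geodesic_vector (randers ta X) Y ->
  exists p phi, chart_at p phi /\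
    forall j, inner ta p phi (Y p phi) (lie_bracket Y (tnth E j) p phi) = 0.
Proof.
move=> dg Y0 [LY _ [_ geo]]; have [phi c0] := chart_exists (lie_exp (0 *: Y)).
exists (lie_exp (0 *: Y)), phi; split => //.
apply: (geodesic_equation c0 dg LY Y0).1.
have [_ eqs] := geo 0 phi c0; have [e1 e2] := exp_derivatives LY c0.
by apply/rowP => i; have := eqs i; cbv zeta; rewrite e1 e2 !mxE.
Qed.

Lemma orthogonal_geodesic_vector Y : douglas (randers ta X) ->
  left_invariant Y -> Y <> 0 ->
  (forall p phi, chart_at p phi ->
    forall j, inner ta p phi (Y p phi) (lie_bracket Y (tnth E j) p phi) = 0) ->
  geodesic_vector (randers ta X) Y.
Proof.
move=> dg LY Y0 inner0; split=> //.
split=> [|t phi ct x]; first by case: (lie_exp_one_param LY).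
have [e1 e2] := exp_derivatives LY ct.
rewrite (e1 : x^`()%classic t = _) (e2 : x^`(2)%classic t = _).
split=> [|i]; first exact: left_invariant_neq0.
have /rowP/(_ i) := (geodesic_equation ct dg LY Y0).2 (inner0 _ _ ct).
by rewrite !mxE.
Qed.

End InvariantRanders.

(** * The quadratic equations for geodesic vectors in the five dimensional algebra *)

Section L55.
Context {R : realType} {G : lieGroupType R 5} (ta : metric G).
Context (E1 E2 E3 E4 E5 : vfield G).
Let E := [tuple E1; E2; E3; E4; E5].
Hypothesis E_basis : lie_algebra_basis E.
Hypothesis E_orthonormal : orthonormal_frame ta E.
Context (a b c d e : R).
Hypotheses (E12 : lie_bracket E1 E2 = a *: E4 + b *: E5)
  (E13 : lie_bracket E1 E3 = c *: E5) (E14 : lie_bracket E1 E4 = d *: E5)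
  (E15 : lie_bracket E1 E5 = 0) (E23 : lie_bracket E2 E3 = e *: E5)
  (E24 : lie_bracket E2 E4 = 0) (E25 : lie_bracket E2 E5 = 0)
  (E34 : lie_bracket E3 E4 = 0) (E35 : lie_bracket E3 E5 = 0)
  (E45 : lie_bracket E4 E5 = 0).

Lemma sum_frame5 (y : 'I_5 -> R) : exists v1 v2 v3 v4 v5 : R,
  \sum_i y i *: tnth E i = v1 *: E1 + (v2 *: E2 + (v3 *: E3 + (v4 *: E4 + v5 *: E5))).
Proof. by do 5!eexists; rewrite !big_ord_recl big_ord0 addr0; reflexivity. Qed.

(** Every bracket lies in the span of [E4] and [E5], so only the coordinates [v4] and [v5] of [Y]
    are paired with it. Indices start at 0: entry [j] belongs to the frame field with number j +
    1. *)
Lemma inner_lie_bracket5 (v1 v2 v3 v4 v5 : R) p phi : chart_at p phi ->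
  let Y := v1 *: E1 + (v2 *: E2 + (v3 *: E3 + (v4 *: E4 + v5 *: E5))) in
  forall j, inner ta p phi (Y p phi) (lie_bracket Y (tnth E j) p phi) =
    nth 0 [:: - (a * v2 * v4) - (b * v2 + c * v3 + d * v4) * v5;
              a * v1 * v4 + (b * v1 - e * v3) * v5;
              (c * v1 + e * v2) * v5; d * v1 * v5; 0] j.
Proof.
move=> cp Y j; pose y (i : 'I_5) := nth 0 [:: v1; v2; v3; v4; v5] i.
have YE : Y = \sum_i y i *: tnth E i by rewrite !big_ord_recl big_ord0 addr0.
have Y4 : inner ta p phi (Y p phi) (E4 p phi) = v4.
  by rewrite YE; apply: (inner_frame E_orthonormal y (@Ordinal 5 3 isT) cp).
have Y5 : inner ta p phi (Y p phi) (E5 p phi) = v5.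
  by rewrite YE; apply: (inner_frame E_orthonormal y (@Ordinal 5 4 isT) cp).
have Y45 x4 x5 : inner ta p phi (Y p phi) (x4 *: E4 p phi + x5 *: E5 p phi) =
    x4 * v4 + x5 * v5.
  by rewrite innerE bformDr !bformZr -!innerE Y4 Y5.
have vE i : is_vfield (tnth E i) by have [/(_ i)[]] := E_basis.
rewrite [in lie_bracket Y _]YE lie_bracket_suml //.
have brC Z W := lie_bracketC Z W cp.
have br0 Z : lie_bracket Z Z p phi = 0 by rewrite lie_bracketE // subrr.
have b12 : lie_bracket E1 E2 p phi = a *: E4 p phi + b *: E5 p phi by rewrite E12.
have b13 : lie_bracket E1 E3 p phi = c *: E5 p phi by rewrite E13.
have b14 : lie_bracket E1 E4 p phi = d *: E5 p phi by rewrite E14.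
have b15 : lie_bracket E1 E5 p phi = 0 by rewrite E15.
have b23 : lie_bracket E2 E3 p phi = e *: E5 p phi by rewrite E23.
have b24 : lie_bracket E2 E4 p phi = 0 by rewrite E24.
have b25 : lie_bracket E2 E5 p phi = 0 by rewrite E25.
have b34 : lie_bracket E3 E4 p phi = 0 by rewrite E34.
have b35 : lie_bracket E3 E5 p phi = 0 by rewrite E35.
have b45 : lie_bracket E4 E5 p phi = 0 by rewrite E45.
have sumE (L : vfield G -> 'rV[R]_5) : \sum_i y i *: L (tnth E i) =
    v1 *: L E1 + (v2 *: L E2 + (v3 *: L E3 + (v4 *: L E4 + v5 *: L E5))).
  by rewrite !big_ord_recl big_ord0 addr0.
rewrite (sumE (fun W => lie_bracket W (tnth E j) p phi)).
have sumL x4 x5 (V : 'rV[R]_5) : V = x4 *: E4 p phi + x5 *: E5 p phi ->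
    inner ta p phi (Y p phi) V = x4 * v4 + x5 * v5 by move=> ->.
case: j => -[|[|[|[|[|//]]]]] j5 /=; rewrite /tnth /=.
- rewrite (brC E2) (brC E3) (brC E4) (brC E5) br0 b12 b13 b14 b15.
  rewrite (sumL (- (a * v2)) (- (b * v2 + c * v3 + d * v4))); first by ring.
  by apply/rowP => i; rewrite !mxE; ring.
- rewrite (brC E3) (brC E4) (brC E5) br0 b12 b23 b24 b25.
  rewrite (sumL (a * v1) (b * v1 - e * v3)); first by ring.
  by apply/rowP => i; rewrite !mxE; ring.
- rewrite (brC E4) (brC E5) br0 b13 b23 b34 b35.
  rewrite (sumL 0 (c * v1 + e * v2)); first by ring.
  by apply/rowP => i; rewrite !mxE; ring.
- rewrite (brC E5) br0 b14 b24 b34 b45.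
  rewrite (sumL 0 (d * v1)); first by ring.
  by apply/rowP => i; rewrite !mxE; ring.
- rewrite br0 b15 b25 b35 b45.
  rewrite (sumL 0 0); first by ring.
  by apply/rowP => i; rewrite !mxE; ring.
Qed.

End L55.

Theorem theorem3p11 (R : realType) (G : lieGroupType R 5)
  (G_simply_connected : simply_connected R G)
  (G_nilpotent : nilpotent_group G)
  (ta : metric G)
  (ta_riemannian : riemannian_metric ta)
  (ta_invariant : left_invariant_metric ta)
  (E1 E2 E3 E4 E5 : vfield G)
  (E_basis : lie_algebra_basis [tuple E1; E2; E3; E4; E5])
  (E_orthonormal : orthonormal_frame ta [tuple E1; E2; E3; E4; E5])
  (a b c d e : R)
  (a_gt0 : 0 < a) (d_gt0 : 0 < d) (e_gt0 : 0 < e)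
  (b_ge0 : 0 <= b) (c_ge0 : 0 <= c)
  (E12 : lie_bracket E1 E2 = a *: E4 + b *: E5)
  (E13 : lie_bracket E1 E3 = c *: E5)
  (E14 : lie_bracket E1 E4 = d *: E5)
  (E15 : lie_bracket E1 E5 = 0)
  (E23 : lie_bracket E2 E3 = e *: E5)
  (E24 : lie_bracket E2 E4 = 0)
  (E25 : lie_bracket E2 E5 = 0)
  (E34 : lie_bracket E3 E4 = 0)
  (E35 : lie_bracket E3 E5 = 0)
  (E45 : lie_bracket E4 E5 = 0)
  (X : vfield G)
  (X_invariant : left_invariant X)
  (X_lt1 : forall p phi, chart_at p phi ->
    Num.sqrt (inner ta p phi (X p phi) (X p phi)) < 1)
  (F_douglas : douglas (randers ta X))
  (Y : vfield G)
  (Y_invariant : left_invariant Y)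
  (Y_neq0 : Y <> 0) :
  geodesic_vector (randers ta X) Y <->
  in_span [tuple E1; E2; E3] Y \/ in_span [tuple E3; E4] Y \/
  in_span [tuple E5] Y.
Proof.
have spanE k (F : k.-tuple (vfield G)) (Z : vfield G) (z : 'I_k -> R) :
    Z = \sum_i z i *: tnth F i -> in_span F Z by exists z.
have bracket v1 v2 v3 v4 v5 := @inner_lie_bracket5 _ _ _ _ _ _ _ _ E_basis E_orthonormal
  a b c d e E12 E13 E14 E15 E23 E24 E25 E34 E35 E45 v1 v2 v3 v4 v5.
have geodesicI v1 v2 v3 v4 v5 :
    Y = v1 *: E1 + (v2 *: E2 + (v3 *: E3 + (v4 *: E4 + v5 *: E5))) ->
    (forall j : 'I_5, nth 0 [:: - (a * v2 * v4) - (b * v2 + c * v3 + d * v4) * v5;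
              a * v1 * v4 + (b * v1 - e * v3) * v5;
              (c * v1 + e * v2) * v5; d * v1 * v5; 0] j = 0) ->
    geodesic_vector (randers ta X) Y.
  move=> YE eqs.
  apply: (orthogonal_geodesic_vector ta_riemannian E_basis E_orthonormal X_invariant
    X_lt1 F_douglas Y_invariant Y_neq0) => p phi cp j.
  by rewrite YE bracket // eqs.
split=> [geo|].
  have [p [phi [cp inner0]]] := geodesic_vector_orthogonal ta_riemannian E_basis
    E_orthonormal X_invariant X_lt1 F_douglas Y_neq0 geo.
  have [y YE] := left_invariant_coord E_basis Y_invariant.
  have [v1 [v2 [v3 [v4 [v5 vE]]]]] := sum_frame5 E1 E2 E3 E4 E5 y.
  rewrite vE in YE.
  have eqs j := bracket v1 v2 v3 v4 v5 p phi cp j.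
  rewrite -YE in eqs; have {}eqs j := etrans (esym (eqs j)) (inner0 j).
  have /= h1 := eqs (@Ordinal 5 0 isT); have /= h2 := eqs (@Ordinal 5 1 isT).
  have /= h3 := eqs (@Ordinal 5 2 isT); have /= h4 := eqs (@Ordinal 5 3 isT).
  (* For v5 = 0 the equations reduce to a v1 v4 = a v2 v4 = 0: either v4 = 0, the first span, or v1
     = v2 = 0, the second. *)
  have [v50|v50] := eqVneq v5 0.
    have [v40|v40] := eqVneq v4 0.
      left; apply: (spanE _ _ _ (fun i => nth 0 [:: v1; v2; v3] i)).
      by rewrite YE v40 v50 !scale0r !addr0 !big_ord_recl big_ord0 addr0.
    have v10 : v1 = 0.
      apply/eqP; move/eqP: h2; rewrite v50 mulr0 addr0 !mulf_eq0 (gt_eqF a_gt0).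
      by rewrite (negPf v40) orbF.
    have v20 : v2 = 0.
      apply/eqP; move/eqP: h1; rewrite v50 mulr0 subr0 oppr_eq0 !mulf_eq0.
      by rewrite (gt_eqF a_gt0) (negPf v40) orbF.
    right; left; apply: (spanE _ _ _ (fun i => nth 0 [:: v3; v4] i)).
    by rewrite YE v10 v20 v50 !scale0r !addr0 !add0r !big_ord_recl big_ord0 addr0.
  (* For v5 nonzero the system is triangular when read upwards: [h4], [h3], [h2] and [h1] give v1,
     v2, v3 and v4 equal to 0 in this order, as [d] and [e] are positive. *)
  have v10 : v1 = 0.
    apply/eqP; move/eqP: h4; rewrite !mulf_eq0 (gt_eqF d_gt0) (negPf v50).
    by rewrite orbF.
  have v20 : v2 = 0.
    apply/eqP; move/eqP: h3; rewrite v10 mulr0 add0r !mulf_eq0 (gt_eqF e_gt0).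
    by rewrite (negPf v50) orbF.
  have v30 : v3 = 0.
    apply/eqP; move/eqP: h2; rewrite v10 !(mulr0, mul0r) !add0r mulf_eq0 oppr_eq0.
    by rewrite mulf_eq0 (gt_eqF e_gt0) (negPf v50) orbF.
  have v40 : v4 = 0.
    apply/eqP; move/eqP: h1; rewrite v20 v30 !(mulr0, mul0r, oppr0) !add0r oppr_eq0.
    by rewrite !mulf_eq0 (gt_eqF d_gt0) (negPf v50) orbF.
  right; right; apply: (spanE _ _ _ (fun=> v5)).
  by rewrite YE v10 v20 v30 v40 !scale0r !add0r !big_ord_recl big_ord0 addr0.
(* Conversely, on each of the three spans every product in the list has a zero factor; the five
   indices are treated together by showing the list to be zero. *)
have nth0 (s : seq R) (j : 'I_5) : s = nseq 5 0 -> nth 0 s j = 0.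
  by move=> ->; rewrite nth_nseq if_same.
case=> [|[]] [z]; rewrite !big_ord_recl big_ord0 addr0 => YE.
- apply: (geodesicI (z ord0) (z (lift ord0 ord0)) (z (lift ord0 (lift ord0 ord0))) 0 0).
    by rewrite YE !scale0r !addr0.
  by move=> j; apply: nth0; rewrite !(mulr0, oppr0, addr0).
- apply: (geodesicI 0 0 (z ord0) (z (lift ord0 ord0)) 0).
    by rewrite YE !scale0r !addr0 !add0r.
  by move=> j; apply: nth0; rewrite !(mulr0, mul0r, oppr0, addr0).
- apply: (geodesicI 0 0 0 0 (z ord0)).
    by rewrite YE !scale0r !add0r.
  by move=> j; apply: nth0; rewrite !(mulr0, mul0r, oppr0, addr0).
Qed.
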